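(* Let $\mathcal M$ be a von Neumann algebra. Then $$\tau_{\|\cdot\|}(\mathcal M_*^s)=\tau_o(\mathcal M_*^s)=\tau_{os}(\mathcal M_*^s).$$ In particular, $\mathcal M_*^s$ is monotone order separable.
   Context: $\mathcal M_*^s$ is the set of hermitian elements of the predual $\mathcal M_*$ (functionals real-valued on self-adjoint elements), partially ordered by $\varphi\le\psi$ iff $\varphi(x)\le\psi(x)$ for all positive $x\in\mathcal M$; $\tau_{\|\cdot\|}(\mathcal M_*^s)$ is its norm topology. Order topologies: let $(P,\le)$ be a poset. For a net, $x_\gamma\uparrow x$ (resp. $x_\gamma\downarrow x$) means that the net is increasing with supremum $x$ in $P$ (resp. decreasing with infimum $x$ in $P$). A net $(x_\gamma)_{\gamma\in\Gamma}$ in $P$ order converges to $x\in P$ if there are nets $(y_\gamma)_{\gamma\in\Gamma}$, $(z_\gamma)_{\gamma\in\Gamma}$ in $P$ with $y_\gamma\le x_\gamma\le z_\gamma$ for all $\gamma$, $y_\gamma\uparrow x$ and $z_\gamma\downarrow x$. A subset $X\subset P$ is order-closed (resp. sequentially order-closed) if no net (resp. no sequence) in $X$ order converges to a point outside $X$. The order topology $\tau_o(P)$ (resp. sequential order topology $\tau_{os}(P)$) is the topology whose closed sets are exactly the order-closed (resp. sequentially order-closed) sets. $P$ is monotone order separable if for every increasing (resp. decreasing) net $(x_\gamma)_{\gamma\in\Gamma}$ in $P$ having a supremum (resp. infimum) there is an increasing sequence $(\gamma_n)$ in $\Gamma$ (so that $(x_{\gamma_n})$ is an increasing, resp. decreasing,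 sequence) such that $\bigvee_n x_{\gamma_n}=\bigvee_{\gamma} x_\gamma$ (resp. $\bigwedge_n x_{\gamma_n}=\bigwedge_\gamma x_\gamma$). *)

(* Defs.v *)
From HB Require Import structures.
From mathcomp Require Import all_boot all_order all_algebra.
From mathcomp Require Import complex.
From mathcomp Require Import all_classical all_reals all_analysis.
Import numFieldNormedType.Exports.
Set Implicit Arguments.
Unset Strict Implicit.
Unset Printing Implicit Defensive.
Import Order.TTheory GRing.Theory Num.Theory.
Local Open Scope classical_set_scope.
Local Open Scope ring_scope.

Record directedSet := DirectedSet {
  directed_sort :> Type;
  dle : directed_sort -> directed_sort -> Prop;
  directed_inhabited : inhabited directed_sort;
  dle_refl : forall a, dle a a;
  dle_trans : forall b a c, dle a b -> dle b c -> dle a c;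
  dle_directed : forall a b, exists2 c, dle a c & dle b c }.

Lemma nat_directed_inhabited : inhabited nat. Proof. exact: inhabits 0%N. Qed.
Lemma nat_directed_trans (b a c : nat) : (a <= b -> b <= c -> a <= c)%N.
Proof. exact: leq_trans. Qed.
Lemma nat_directed_ub (a b : nat) : exists2 c, (a <= c)%N & (b <= c)%N.
Proof. by exists (maxn a b); rewrite ?leq_maxl ?leq_maxr. Qed.

Definition nat_directed : directedSet :=
  @DirectedSet nat (fun m n => (m <= n)%N)
    nat_directed_inhabited leqnn nat_directed_trans nat_directed_ub.

Section OrderConvergence.
Context {d : Order.disp_t} {P : porderType d}.
Implicit Types (G : directedSet) (l : P) (X : set P).

Definition increasing_net G (x : G -> P) :=
  forall a b, dle a b -> (x a <= x b)%O.

Definition decreasing_net G (x : G -> P) :=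
  forall a b, dle a b -> (x b <= x a)%O.

Definition net_up G (x : G -> P) l :=
  increasing_net x /\ supremums (range x) l.

Definition net_down G (x : G -> P) l :=
  decreasing_net x /\ infimums (range x) l.

Definition order_cvg G (x : G -> P) l := exists y z : G -> P,
  [/\ forall a, (y a <= x a)%O /\ (x a <= z a)%O, net_up y l & net_down z l].

Definition order_closed X := forall G (x : G -> P) l,
  (forall a, X (x a)) -> order_cvg x l -> X l.

Definition seq_order_closed X := forall (x : nat_directed -> P) l,
  (forall n, X (x n)) -> order_cvg x l -> X l.

Lemma order_cvg_comp G G' (f : G' -> G) (x : G -> P) l :
  (forall a b, dle a b -> dle (f a) (f b)) ->
  (forall a, exists b, dle a (f b)) ->
  order_cvg x l -> order_cvg (x \o f) l.
Proof.
move=> fm fc [y [z [yxz [yi [yu yl]] [zd [zl zu]]]]].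
exists (y \o f), (z \o f); split=> [a| |]; first exact: yxz.
- split=> [a b ab|]; first exact/yi/fm.
  split=> [_ [a _ <-]|u ub]; first by apply: yu; exists (f a).
  apply: yl => _ [a _ <-]; have [b ab] := fc a.
  by apply: le_trans (yi _ _ ab) _; apply: ub; exists b.
- split=> [a b ab|]; first exact/zd/fm.
  split=> [_ [a _ <-]|u ub]; first by apply: zl; exists (f a).
  apply: zu => _ [a _ <-]; have [b ab] := fc a.
  by apply: le_trans _ (zd _ _ ab); apply: ub; exists b.
Qed.

Lemma order_closed0 : order_closed set0.
Proof. by move=> G x l x0; have [a] := directed_inhabited G; case: (x0 a). Qed.

Lemma order_closed_bigcap (I : Type) (F : I -> set P) :
  (forall i, order_closed (F i)) -> order_closed (\bigcap_i F i).
Proof. by move=> Fc G x l Fx xl i _; apply: Fc xl => a; apply: Fx. Qed.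

Lemma order_closedU X Y :
  order_closed X -> order_closed Y -> order_closed (X `|` Y).
Proof.
move=> Xc Yc G x l XYx xl.
have restr (S : set G) : (forall a, exists2 b, dle a b & S b) ->
    exists (G' : directedSet) (f : G' -> G), (forall a, S (f a)) /\
      order_cvg (x \o f) l.
  move=> Scof.
  have inh : inhabited {a | S a}.
    have [a] := directed_inhabited G.
    by have [b _ Sb] := Scof a; exact: inhabits (exist _ b Sb).
  have dir (a b : {a | S a}) : exists2 c : {a | S a},
      dle (sval a) (sval c) & dle (sval b) (sval c).
    have [c ac bc] := dle_directed (sval a) (sval b).
    have [e ce Se] := Scof c.
    exists (exist _ e Se) => /=; first exact: dle_trans ac ce.
    exact: dle_trans bc ce.
  pose G' := @DirectedSet {a | S a} (fun a b => dle (sval a) (sval b))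
    inh (fun a => dle_refl (sval a))
    (fun b a c => @dle_trans G (sval b) (sval a) (sval c)) dir.
  exists G', sval; split; first by case.
  apply: order_cvg_comp xl => [//|a].
  by have [b ab Sb] := Scof a; exists (exist _ b Sb).
have [cof|] := pselect (forall a, exists2 b, dle a b & X (x b)).
  by have [G' [f [Xf fl]]] := restr [set b | X (x b)] cof; left; apply: Xc fl.
move=> /existsNP[a0 a0P]; right.
have [|G' [f [a0f fl]]] := restr [set b | dle a0 b].
  by move=> a; have [c ac a0c] := dle_directed a a0; exists c.
apply: Yc fl => a; case: (XYx (f a)) => // Xfa.
by exfalso; apply: a0P; exists (f a); first exact: a0f.
Qed.

Lemma seq_order_closed0 : seq_order_closed set0.
Proof. by move=> x l x0; case: (x0 0%N). Qed.

Lemma seq_order_closed_bigcap (I : Type) (F : I -> set P) :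
  (forall i, seq_order_closed (F i)) -> seq_order_closed (\bigcap_i F i).
Proof. by move=> Fc x l Fx xl i _; apply: Fc xl => a; apply: Fx. Qed.

Lemma seq_order_closedU X Y :
  seq_order_closed X -> seq_order_closed Y -> seq_order_closed (X `|` Y).
Proof.
move=> Xc Yc x l XYx xl.
have [cof|] := pselect (forall a, exists b : nat, (a <= b)%N /\ X (x b)).
  left; have {cof} [g gP] := choice cof.
  pose f := fix f n := if n is m.+1 then g (f m).+1 else g 0%N.
  have Xf n : X (x (f n)) by case: n => [|n] /=; exact: (gP _).2.
  have fS n : (f n < f n.+1)%N by exact: (gP _).1.
  apply: (Xc (x \o f)) => //.
  apply: (@order_cvg_comp nat_directed nat_directed) xl => [a b|a].
    apply: (@homo_leq _ f leq) => //; last by move=> n; exact/ltnW.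
    exact: leq_trans.
  exists a; elim: a => //= n ih; exact: leq_ltn_trans ih (fS n).
move=> /existsNP[a0 a0P]; right.
apply: (Yc (fun n => x (a0 + n)%N)) => [n|].
  case: (XYx (a0 + n)%N) => // Xn.
  by exfalso; apply: a0P; exists (a0 + n)%N; rewrite leq_addr.
apply: (@order_cvg_comp nat_directed nat_directed (addn a0)) xl => [a b|a] /=.
  by rewrite leq_add2l.
by exists a; rewrite leq_addl.
Qed.

End OrderConvergence.

(* Copies of P carrying the order topology and the sequential order topology,
   as opposed to any topology P may already have. *)
Definition o_topology {d : Order.disp_t} (P : porderType d) : Type := P.
Definition os_topology {d : Order.disp_t} (P : porderType d) : Type := P.

Section OrderTopology.
Context {d : Order.disp_t} (P : porderType d).

Definition order_open : set_system P := [set U | order_closed (~` U)].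
Definition seq_order_open : set_system P := [set U | seq_order_closed (~` U)].

Lemma order_openT : order_open setT.
Proof. by rewrite /order_open /= setCT; exact: order_closed0. Qed.
Lemma order_openI : setI_closed order_open.
Proof.
by move=> U V /=; rewrite /order_open /= setCI; exact: order_closedU.
Qed.
Lemma order_open_bigU (I : Type) (F : I -> set P) :
  (forall i, order_open (F i)) -> order_open (\bigcup_i F i).
Proof.
by move=> /= Fo; rewrite /order_open /= setC_bigcup; exact: order_closed_bigcap.
Qed.

Lemma seq_order_openT : seq_order_open setT.
Proof. by rewrite /seq_order_open /= setCT; exact: seq_order_closed0. Qed.
Lemma seq_order_openI : setI_closed seq_order_open.
Proof.
by move=> U V /=; rewrite /seq_order_open /= setCI; exact: seq_order_closedU.
Qed.
Lemma seq_order_open_bigU (I : Type) (F : I -> set P) :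
  (forall i, seq_order_open (F i)) -> seq_order_open (\bigcup_i F i).
Proof.
move=> /= Fo; rewrite /seq_order_open /= setC_bigcup.
exact: seq_order_closed_bigcap.
Qed.

HB.instance Definition _ := Choice.copy (o_topology P) P.
HB.instance Definition _ := isOpenTopological.Build (o_topology P)
  order_openT order_openI order_open_bigU.

HB.instance Definition _ := Choice.copy (os_topology P) P.
HB.instance Definition _ := isOpenTopological.Build (os_topology P)
  seq_order_openT seq_order_openI seq_order_open_bigU.

Definition tau_o : set_system P := @open (o_topology P).
Definition tau_os : set_system P := @open (os_topology P).

(* x \o g inherits its monotonicity from x, as g is increasing. *)
Definition monotone_order_separable :=
  (forall (G : directedSet) (x : G -> P) (l : P), net_up x l ->
     exists2 g : nat -> G, (forall n, dle (g n) (g n.+1)) &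
       supremums (range (x \o g)) l) /\
  (forall (G : directedSet) (x : G -> P) (l : P), net_down x l ->
     exists2 g : nat -> G, (forall n, dle (g n) (g n.+1)) &
       infimums (range (x \o g)) l).

End OrderTopology.

Arguments order_open {d} P.
Arguments seq_order_open {d} P.
Arguments tau_o {d} P.
Arguments tau_os {d} P.

Definition tau_norm {K : numFieldType} (V : normedModType K) : set_system V :=
  @open V.

Arguments tau_norm {K} V.

Record hilbertSpace (R : realType) := HilbertSpace {
  hilbert_sort :> completeNormedModType R[i];
  inner : {dot hilbert_sort for @Num.conj R[i]};
  inner_norm : forall u, inner u u = `|u| ^+ 2 }.

Arguments inner {R h}.
Arguments inner_norm {R h}.

Section HilbertTheory.
Context {R : realType} {H : hilbertSpace R}.
Implicit Types u v w : H.

Lemma innerC u v : inner u v = (inner v u)^*%R.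
Proof. by rewrite (hermC inner u v) expr0 mul1r. Qed.
Lemma innerDl u v w : inner (u + v) w = inner u w + inner v w.
Proof. exact: linearDl. Qed.
Lemma innerZl (a : R[i]) u w : inner (a *: u) w = a * inner u w.
Proof. exact: linearZl_LR. Qed.
Lemma innerDr u v w : inner u (v + w) = inner u v + inner u w.
Proof. exact: linearDr. Qed.
Lemma innerZr (a : R[i]) u w : inner u (a *: w) = a^*%R * inner u w.
Proof. exact: linearZr_LR. Qed.
Lemma innerBl u v w : inner (u - v) w = inner u w - inner v w.
Proof. by rewrite -scaleN1r innerDl innerZl mulN1r. Qed.
Lemma innerBr u v w : inner u (v - w) = inner u v - inner u w.
Proof. by rewrite -scaleN1r innerDr innerZr rmorphN1 mulN1r. Qed.
Lemma inner0l u : inner 0 u = 0. Proof. exact: linear0l. Qed.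
Lemma inner0r u : inner u 0 = 0. Proof. exact: linear0r. Qed.

Lemma inner_ext u v : (forall w, inner u w = inner v w) -> u = v.
Proof.
move=> uv; apply/eqP; rewrite -subr_eq0 -normr_eq0 -sqrf_eq0 -inner_norm.
by rewrite innerBl uv subrr.
Qed.

Lemma inner_CauchySchwarz u v : `|inner u v| <= `|u| * `|v|.
Proof.
have [->|v0] := eqVneq v 0; first by rewrite inner0r normr0 mulr_ge0.
have nv0 : 0 < `|v| by rewrite normr_gt0.
rewrite -(@ler_pXn2r _ 2)// ?nnegrE ?mulr_ge0//.
pose a := inner u v / `|v| ^+ 2.
have: 0 <= `|u - a *: v| ^+ 2 by rewrite exprn_ge0.
rewrite -inner_norm innerBl !innerBr !innerZl !innerZr !inner_norm.
have -> : a^*%R = inner v u / `|v| ^+ 2.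
  rewrite (innerC v u) /a fmorph_div /=; congr (_ / _).
  by apply/CrealP; rewrite realX// normr_real.
rewrite /a (divfK _) ?expf_neq0 ?gt_eqF// subrr subr0 mulrAC.
rewrite (innerC v u) [X in X / _]mulrC -normCK subr_ge0.
by rewrite ler_pdivrMr ?exprn_gt0// exprMn.
Qed.

End HilbertTheory.

Section Operators.
Context {R : realType} (H : hilbertSpace R).
Implicit Types (x y : H -> H) (S : set (H -> H)).

Definition bounded_op : set (H -> H) :=
  [set x | linear x /\ continuous x].

Definition is_adjoint x y := forall u v, inner (x u) v = inner u (y v).

Definition positive_op x := forall u, 0 <= inner (x u) u.

Definition commutant S : set (H -> H) :=
  [set y | bounded_op y /\ forall x, S x -> x \o y = y \o x].

(* A self-adjoint set of bounded operators equal to its bicommutant. That it is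
   a unital subalgebra of the bounded operators then follows: see vn_bounded,
   vn_comb, vn_id and vn_comp below. *)
Record vonNeumannAlgebra := VonNeumannAlgebra {
  vn_set : set (H -> H);
  vn_adjoint : forall x, vn_set x -> exists2 y, vn_set y & is_adjoint x y;
  vn_bicommutant : commutant (commutant vn_set) = vn_set }.

Lemma bounded_op_lin x : bounded_op x -> forall (a : R[i]) u v,
  x (a *: u + v) = a *: x u + x v.
Proof. by move=> [xl _] a u v; rewrite xl. Qed.

Lemma bounded_op0 x : bounded_op x -> x 0 = 0.
Proof.
move=> /bounded_op_lin xl; have := xl (-1) 0 0.
by rewrite scaler0 addr0 scaleN1r addNr.
Qed.

Lemma bounded_op_comb (a : R[i]) x y :
  bounded_op x -> bounded_op y -> bounded_op (a *: x + y).
Proof.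
move=> bx bY; split.
  move=> b u v; change (a *: x (b *: u + v) + y (b *: u + v) =
    b *: (a *: x u + y u) + (a *: x v + y v)).
  rewrite (bounded_op_lin bx) (bounded_op_lin bY) !scalerDr !scalerA.
  by rewrite (mulrC b) addrACA.
move=> u; apply: cvgD; last exact: bY.2.
by apply: cvgZr; exact: bx.2.
Qed.

Lemma bounded_op_id : bounded_op (@id H).
Proof. by split=> // u; exact: cvg_id. Qed.

Lemma bounded_op_zero : bounded_op (0 : H -> H).
Proof. by split=> [a u v|u]; [rewrite scaler0 addr0|exact: cvg_cst]. Qed.

Lemma bounded_op_bound x : bounded_op x ->
  exists2 k : R[i], 0 <= k & forall u, `|x u| <= k * `|u|.
Proof.
move=> [xl xc]; pose f : {linear H -> H} := HB.pack x
  (GRing.isLinear.Build R[i] H H *:%R x xl).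
have /pinfty_ex_gt0[k k0 fk] := (linear_boundedP f).1
  (@continuous_linear_bounded _ H H 0 f (xc 0)).
by exists k; [exact: ltW|exact: fk].
Qed.

Lemma commutant_comb S (a : R[i]) x y : S `<=` bounded_op ->
  commutant S x -> commutant S y -> commutant S (a *: x + y).
Proof.
move=> Sb [bx cx] [bY cy]; split; first exact: bounded_op_comb.
move=> s Ss; apply/funext => u /=; have sl := bounded_op_lin (Sb _ Ss).
have /= ey := congr1 (@^~ u) (cy _ Ss); have /= ex := congr1 (@^~ u) (cx _ Ss).
by change (s (a *: x u + y u) = a *: x (s u) + y (s u)); rewrite sl ex ey.
Qed.

End Operators.

Section VonNeumannTheory.
Context {R : realType} {H : hilbertSpace R} (M : vonNeumannAlgebra H).
Implicit Types x y : H -> H.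

Let comM : commutant (vn_set M) `<=` @bounded_op R H.
Proof. by move=> x []. Qed.

Lemma vn_bounded : vn_set M `<=` @bounded_op R H.
Proof. by rewrite -vn_bicommutant => x []. Qed.

Lemma vn_comb (a : R[i]) x y :
  vn_set M x -> vn_set M y -> vn_set M (a *: x + y).
Proof. by rewrite -(vn_bicommutant M); exact: commutant_comb. Qed.

Lemma vn_id : vn_set M id.
Proof. by rewrite -(vn_bicommutant M); split=> //; exact: bounded_op_id. Qed.

Lemma vn_zero : vn_set M 0.
Proof.
rewrite -(vn_bicommutant M); split; first exact: bounded_op_zero.
by move=> x [bx _]; apply/funext => u /=; rewrite bounded_op0.
Qed.

Lemma vn_comp x y : vn_set M x -> vn_set M y -> vn_set M (x \o y).
Proof.
move=> Mx My; rewrite -(vn_bicommutant M); split.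
  have [xl xc] := vn_bounded Mx; have [yl yc] := vn_bounded My.
  split=> [a u v|u] /=; first by rewrite yl xl.
  by apply: continuous_comp; [exact: yc|exact: xc].
have cM z : vn_set M z -> forall s, commutant (vn_set M) s -> s \o z = z \o s.
  by rewrite -{1}(vn_bicommutant M) => -[].
move=> s Ss; have cx := cM _ Mx; have cy := cM _ My.
apply/funext => u /=; have /= ex := congr1 (@^~ (y u)) (cx _ Ss).
by have /= ey := congr1 (@^~ u) (cy _ Ss); rewrite ex ey.
Qed.

Definition vn_pred : pred (H -> H) := fun x => x \in vn_set M.

Lemma vn_submod_closed : submod_closed vn_pred.
Proof.
split; first by apply/mem_set; exact: vn_zero.
by move=> a x y /set_mem Mx /set_mem My; apply/mem_set; exact: vn_comb.
Qed.

HB.instance Definition _ :=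
  GRing.isSubmodClosed.Build R[i] (H -> H) vn_pred vn_submod_closed.

Definition vn_sort := {x : H -> H | vn_pred x}.
HB.instance Definition _ := SubChoice.on vn_sort.
HB.instance Definition _ := [SubChoice_isSubLmodule of vn_sort by <:].

End VonNeumannTheory.

(* The modulus with values in R, whereas `|z| lies in R[i] for z : R[i]. *)
Local Notation normc := ComplexField.Normc.normc.

Section Predual.
Context {R : realType} {H : hilbertSpace R} (M : vonNeumannAlgebra H).
Implicit Types (xi eta : nat -> H) (phi : vn_sort M -> R[i]^o).

Definition square_summable xi :=
  cvgn (series (fun n => `|xi n| ^+ 2) : nat -> R[i]^o).

Definition ell2 := {xi : nat -> H | square_summable xi}.

Definition vector_functional (p : ell2 * ell2) (x : vn_sort M) : R[i]^o :=
  limn (series (fun n => inner (val x (sval p.1 n)) (sval p.2 n))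
        : nat -> R[i]^o).

(* The coarsest topology on M making all the functionals
   x |-> \sum_n <x xi_n, eta_n> continuous, for square summable sequences xi
   and eta of vectors. *)
Definition sigma_weak := @sup_topology (vn_sort M) (ell2 * ell2)%type
  (fun p => Topological.on (initial_topology (vector_functional p))).
HB.instance Definition _ := Topological.on sigma_weak.

Definition predual : set (vn_sort M -> R[i]^o) :=
  [set phi | linear phi /\ continuous (phi : sigma_weak -> R[i]^o)].

Definition hermitian_functional phi := forall x : vn_sort M,
  is_adjoint (val x) (val x) -> phi x \is Num.real.

Definition vn_unit_ball : set (vn_sort M) :=
  [set x | forall u, `|val x u| <= `|u|].

Definition predual_sa_pred : pred (vn_sort M -> R[i]^o) :=
  fun phi => `[< predual phi /\ hermitian_functional phi >].

Lemma predual_sa_comb (a : R[i]) phi psi : a \is Num.real ->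
  predual_sa_pred phi -> predual_sa_pred psi ->
  predual_sa_pred (a *: phi + psi).
Proof.
move=> ar /asboolP[[pl pc] ph] /asboolP[[sl sc] sh]; apply/asboolP; split.
  split.
    move=> b u v; change (a * phi (b *: u + v) + psi (b *: u + v) =
      b * (a * phi u + psi u) + (a * phi v + psi v)).
    rewrite pl sl /GRing.scale /= !mulrDr !mulrA (mulrC b a).
    by rewrite addrACA.
  move=> u; have Fu : Filter (nbhs (u : sigma_weak)) by exact: nbhs_filter.
  apply: (@cvgD R[i] R[i]^o _ (nbhs u) Fu (a *: phi) psi); last exact: sc.
  by apply: (@cvgM R[i] _ (nbhs u) Fu (cst a) phi); [exact: cvg_cst|exact: pc].
move=> x xx; change (a * phi x + psi x \is Num.real).
by rewrite rpredD ?rpredM ?ph ?sh.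
Qed.

Lemma predual_sa_zmod_closed : zmod_closed predual_sa_pred.
Proof.
have p0 : predual_sa_pred 0.
  apply/asboolP; split; last by move=> x _; exact: real0.
  split; first by move=> a u v; rewrite scaler0 addr0.
  move=> u; have Fu : Filter (nbhs (u : sigma_weak)) by exact: nbhs_filter.
  exact: (@cvg_cst R[i]^o _ _ _ Fu).
split=> // phi psi Pphi Ppsi.
have -> : phi - psi = (-1 : R[i]) *: psi + phi by rewrite scaleN1r addrC.
by apply: predual_sa_comb; rewrite // realN real1.
Qed.

HB.instance Definition _ := GRing.isZmodClosed.Build
  (vn_sort M -> R[i]^o) predual_sa_pred predual_sa_zmod_closed.

(* The hermitian part of the predual. *)
Definition predual_sa := {phi : vn_sort M -> R[i]^o | predual_sa_pred phi}.
HB.instance Definition _ := SubChoice.on predual_sa.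
HB.instance Definition _ := [SubChoice_isSubZmodule of predual_sa by <:].

Lemma predual_sa_linear (phi : predual_sa) : linear (val phi).
Proof. by have /asboolP[[]] := valP phi. Qed.
Lemma predual_sa_continuous (phi : predual_sa) :
  continuous (val phi : sigma_weak -> R[i]^o).
Proof. by have /asboolP[[]] := valP phi. Qed.
Lemma predual_sa_hermitian (phi : predual_sa) : hermitian_functional (val phi).
Proof. by have /asboolP[] := valP phi. Qed.

Lemma predual_sa0 (phi : predual_sa) : val phi 0 = 0.
Proof.
by have := predual_sa_linear phi (-1) 0 0; rewrite scaler0 addr0 scaleN1r addNr.
Qed.

Lemma predual_sa_scale_subproof (a : R) (phi : predual_sa) :
  predual_sa_pred (a%:C%C *: val phi).
Proof.
rewrite -[X in predual_sa_pred X]addr0; apply: predual_sa_comb (valP phi) _.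
  by apply/complex_realP; exists a.
exact: (valP (0 : predual_sa)).
Qed.

Definition predual_sa_scale (a : R) (phi : predual_sa) : predual_sa :=
  exist predual_sa_pred _ (predual_sa_scale_subproof a phi).


Lemma ell2_bound (xi : ell2) : exists2 k : R[i], 0 <= k &
  forall n, \sum_(0 <= i < n) `|sval xi i| ^+ 2 <= k.
Proof.
have /pinfty_ex_gt0[k k0 kP] := cvg_seq_bounded (svalP xi).
exists k => [|n]; first exact: ltW.
by have := kP n Logic.I; rewrite /= ger0_norm// sumr_ge0.
Qed.

Lemma limn_norm_le (s : nat -> R[i]^o) (b : R[i]) : 0 <= b ->
  (forall n, `|s n| <= b) -> `|limn s| <= b.
Proof.
move=> b0 sb; have [cs|] := pselect (cvgn s); last first.
  by move=> /dvgP ->; rewrite normr0.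
apply/ler_addgt0Pl => e e0.
have [n _ /(_ n (leqnn n))] := @cvgr_dist_lt _ _ _ _ _ s (limn s) cs e e0.
move=> /= sn; rewrite -(subrK (s n) (limn s)).
by apply: le_trans (ler_normD _ _) _; apply: lerD => //; exact: ltW.
Qed.

Lemma vector_functional_bound p : exists2 k : R[i], 0 <= k &
  forall (c : R[i]) (x : vn_sort M), 0 <= c ->
    (forall u, `|val x u| <= c * `|u|) -> `|vector_functional p x| <= c * k.
Proof.
have [k1 k10 k1P] := ell2_bound p.1; have [k2 k20 k2P] := ell2_bound p.2.
exists (k1 + k2) => [|c x c0 xc]; first exact: addr_ge0.
apply: limn_norm_le => [|n]; first by rewrite mulr_ge0 ?addr_ge0.
apply: le_trans (ler_norm_sum _ _ _) _.
apply: (@le_trans _ _ (\sum_(0 <= i < n)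
    c * (`|sval p.1 i| ^+ 2 + `|sval p.2 i| ^+ 2))); last first.
  by rewrite -mulr_sumr big_split ler_wpM2l// lerD.
apply: ler_sum => i _; apply: le_trans (inner_CauchySchwarz _ _) _.
apply: (@le_trans _ _ (c * (`|sval p.1 i| * `|sval p.2 i|))).
  by rewrite mulrA ler_wpM2r.
rewrite ler_wpM2l//.
apply: le_trans (real_leif_mean_square_scaled (normr_real _) (normr_real _)).
by rewrite mulr2n lerDl mulr_ge0.
Qed.

Lemma predual_sa_has_ubound (phi : predual_sa) :
  has_ubound [set normc (val phi x) | x in vn_unit_ball].
Proof.
apply: contrapT => nub.
have /choice[x xP] : forall n : nat, exists x, vn_unit_ball x /\
    n.+1%:R ^+ 2 < normc (val phi x).
  move=> n; apply: contrapT => /forallNP xn; apply: nub.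
  exists (n.+1%:R ^+ 2) => _ [x bx <-]; rewrite leNgt; apply/negP => ltx.
  by apply: (xn x).
pose y n : vn_sort M := (n.+1%:R^-1 : R[i]) *: x n.
have yP n u : `|val (y n) u| <= n.+1%:R^-1 * `|u|.
  have -> : val (y n) u = (n.+1%:R^-1 : R[i]) *: val (x n) u by [].
  rewrite normrZ ger0_norm ?invr_ge0// ler_wpM2l ?invr_ge0//.
  exact: (xP n).1.
have y0 : y @ \oo --> (0 : sigma_weak).
  apply/cvg_sup => p A; rewrite nbhsE => -[B [[C Co <-] C0] CA].
  have [k k0 kP] := vector_functional_bound p.
  have f0 : vector_functional p 0 = 0.
    apply/eqP; rewrite -normr_le0 -(mul0r k); apply: kP => // u.
    by rewrite normr0 mul0r.
  have yf : (fun n => vector_functional p (y n)) @ \oo --> (0 : R[i]^o).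
    apply/cvgr0Pnorm_lt => e e0.
    have /complex_realP[e' eE] := gtr0_real e0.
    have /complex_realP[k' kE] := ger0_real k0.
    exists (Num.bound `|k' / e'|) => // n /= ltn.
    apply: le_lt_trans (kP _ (y n) _ (yP n)) _; first by rewrite invr_ge0.
    rewrite mulrC ltr_pdivrMr// mulrC -(rmorph_nat (real_complex R)).
    rewrite eE kE -rmorphM /= ltcR.
    move: e0; rewrite eE ltcR => e0.
    rewrite -ltr_pdivrMr//; apply: le_lt_trans (ler_norm _) _.
    apply: lt_le_trans (archi_boundP (normr_ge0 _)) _.
    by rewrite ler_nat (leq_trans ltn).
  move: C0; rewrite /preimage /= f0 => C0.
  have [N _ NP] := yf C (open_nbhs_nbhs (conj Co C0)).
  by exists N => // n Nn; apply: CA; exact: NP.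
have := @cvg_comp _ _ _ y (val phi) _ _ _ y0
  (@predual_sa_continuous phi (0 : sigma_weak)).
rewrite predual_sa0 => /cvgr_dist_lt /(_ 1 ltr01)[n _ /(_ n (leqnn n))] /=.
have -> : val phi (y n) = (n.+1%:R^-1 : R[i]) * val phi (x n).
  have := predual_sa_linear phi (n.+1%:R^-1) (x n) 0.
  by rewrite addr0 predual_sa0 addr0.
rewrite sub0r normrN normrM ger0_norm ?invr_ge0// mulrC ltr_pdivrMr// mul1r.
rewrite -(rmorph_nat (real_complex R)) ltcR => /(lt_trans (xP n).2).
by rewrite ltNge -[X in X <= _]mulr1 expr2 ler_wpM2l// ler1n.
Qed.

Lemma predual_sa_scaleA (a b : R) (phi : predual_sa) :
  predual_sa_scale a (predual_sa_scale b phi) = predual_sa_scale (a * b) phi.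
Proof. by apply: val_inj; rewrite /= scalerA rmorphM. Qed.
Lemma predual_sa_scale1 : left_id 1 predual_sa_scale.
Proof. by move=> phi; apply: val_inj; rewrite /= rmorph1 scale1r. Qed.
Lemma predual_sa_scaleDr : right_distributive predual_sa_scale +%R.
Proof. by move=> a phi psi; apply: val_inj; rewrite /= scalerDr. Qed.
Lemma predual_sa_scaleDl (phi : predual_sa) :
  {morph predual_sa_scale^~ phi : a b / a + b}.
Proof. by move=> a b; apply: val_inj; rewrite /= rmorphD scalerDl. Qed.

HB.instance Definition _ := GRing.Zmodule_isLmodule.Build R predual_sa
  predual_sa_scaleA predual_sa_scale1 predual_sa_scaleDr predual_sa_scaleDl.

(* The norm of the dual Banach space of M. *)
Definition predual_sa_norm (phi : predual_sa) : R :=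
  sup [set normc (val phi x) | x in vn_unit_ball].

Lemma predual_sa_norm_ub (phi : predual_sa) x :
  vn_unit_ball x -> normc (val phi x) <= predual_sa_norm phi.
Proof.
by move=> xb; apply: (ub_le_sup (predual_sa_has_ubound phi)); exists x.
Qed.

Lemma predual_sa_norm_le (phi : predual_sa) (c : R) :
  (forall x, vn_unit_ball x -> normc (val phi x) <= c) ->
  predual_sa_norm phi <= c.
Proof.
move=> phic; apply: ge_sup => [|_ [x xb <-]]; last exact: phic.
by exists (normc (val phi 0)), 0 => // u; rewrite normr0.
Qed.

Lemma predual_sa_normD (phi psi : predual_sa) :
  predual_sa_norm (phi + psi) <= predual_sa_norm phi + predual_sa_norm psi.
Proof.
apply: predual_sa_norm_le => x xb.
apply: le_trans (le_normcD (val phi x) (val psi x)) _.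
by rewrite lerD ?predual_sa_norm_ub.
Qed.

Lemma predual_sa_normZ (a : R) (phi : predual_sa) :
  predual_sa_norm (a *: phi) = `|a| * predual_sa_norm phi.
Proof.
have le b psi : predual_sa_norm (b *: psi) <= `|b| * predual_sa_norm psi.
  apply: predual_sa_norm_le => x xb.
  change (normc (b%:C%C * val psi x) <= `|b| * predual_sa_norm psi).
  rewrite ComplexField.Normc.normcM /= expr0n /= addr0 sqrtr_sqr.
  by rewrite ler_wpM2l ?predual_sa_norm_ub.
apply/eqP; rewrite eq_le le /=.
have [->|a0] := eqVneq a 0.
  rewrite normr0 mul0r; apply: le_trans (predual_sa_norm_ub _ (x := 0) _) => //.
    by rewrite predual_sa0 /= expr0n /= addr0 sqrtr0.
  by move=> u; rewrite normr0.
rewrite mulrC -ler_pdivlMr ?normr_gt0// mulrC -normfV.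
by have := le a^-1 (a *: phi); rewrite scalerA mulVf// scale1r.
Qed.

Lemma predual_sa_norm_eq0 (phi : predual_sa) :
  predual_sa_norm phi = 0 -> phi = 0.
Proof.
move=> phi0; apply: val_inj; apply/funext => x /=.
have [k k0 kP] := bounded_op_bound (vn_bounded (set_mem (valP x))).
have k1 : 0 < k + 1 by rewrite ltr_wpDl.
have : vn_unit_ball ((k + 1)^-1 *: x).
  move=> u; have -> : val ((k + 1)^-1 *: x) u = (k + 1)^-1 *: val x u by [].
  rewrite normrZ ger0_norm ?invr_ge0 ?(ltW k1)// ler_pdivrMl//.
  by apply: le_trans (kP u) _; rewrite ler_wpM2r// lerDl.
move=> /(predual_sa_norm_ub phi); rewrite phi0 -lecR => xle.
have -> : val phi x = (k + 1) * val phi ((k + 1)^-1 *: x).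
  have := predual_sa_linear phi ((k + 1)^-1) x 0.
  rewrite addr0 predual_sa0 addr0 => ->.
  by rewrite /GRing.scale /= mulrA divff ?mul1r// gt_eqF.
suff -> : val phi ((k + 1)^-1 *: x) = 0 by rewrite mulr0.
by apply/eqP; rewrite -normr_le0.
Qed.

HB.instance Definition _ := Lmodule_isNormed.Build R predual_sa
  predual_sa_normD predual_sa_normZ predual_sa_norm_eq0.

Definition predual_sa_le (phi psi : predual_sa) : bool :=
  `[< forall x : vn_sort M, positive_op (val x) -> val phi x <= val psi x >].

Lemma predual_sa_le_refl : reflexive predual_sa_le.
Proof. by move=> phi; apply/asboolP. Qed.

Lemma predual_sa_le_trans : transitive predual_sa_le.
Proof.
move=> psi phi chi /asboolP pp /asboolP pc; apply/asboolP => x x0.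
exact: le_trans (pp x x0) (pc x x0).
Qed.

Lemma sa_add_positive (x : H -> H) (k : R[i]) : is_adjoint x x ->
  (forall u, `|x u| <= k * `|u|) -> positive_op (k *: id + x).
Proof.
move=> xx xk u; change (0 <= inner (k *: u + x u) u).
rewrite innerDl innerZl inner_norm.
have xr : inner (x u) u \is Num.real by apply/CrealP; rewrite -innerC xx.
have := le_trans (inner_CauchySchwarz (x u) u) (ler_wpM2r (normr_ge0 u) (xk u)).
rewrite -mulrA -expr2 real_ler_norml// => /andP[+ _].
by rewrite -subr_ge0 opprK addrC.
Qed.

Lemma predual_sa_le_anti : antisymmetric predual_sa_le.
Proof.
move=> phi psi /andP[/asboolP pp /asboolP qp].
have eqp x : positive_op (val x) -> val phi x = val psi x.
  by move=> x0; apply/eqP; rewrite eq_le pp ?qp.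
pose e : vn_sort M := exist (vn_pred M) id (mem_set (vn_id M)).
have eqs x : is_adjoint (val x) (val x) -> val phi x = val psi x.
  move=> xx; have [k k0 kP] := bounded_op_bound (vn_bounded (set_mem (valP x))).
  have := eqp _ (sa_add_positive xx kP : positive_op (val (k *: e + x))).
  rewrite (predual_sa_linear phi) (predual_sa_linear psi) (eqp e) => [|u].
    exact: addrI.
  by rewrite inner_norm exprn_ge0.
apply: val_inj; apply/funext => x.
have [y My xy] := vn_adjoint (set_mem (valP x)).
pose z : vn_sort M := exist (vn_pred M) y (mem_set My).
have yx u v : inner (y u) v = inner u (val x v) by rewrite innerC -xy -innerC.
have hh : is_adjoint (val (x + z)) (val (x + z)).
  move=> u v; change (inner (val x u + y u) v = inner u (val x v + y v)).
  by rewrite innerDl innerDr xy yx addrC.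
have kk : is_adjoint (val ('i *: (x - z))) (val ('i *: (x - z))).
  move=> u v; change (inner ('i *: (val x u - y u)) v =
    inner u ('i *: (val x v - y v))).
  rewrite innerZl innerZr innerBl innerBr xy yx conjCi.
  by rewrite mulNr -mulrN opprB.
have -> : x = (2^-1 : R[i]) *: (- 'i *: ('i *: (x - z)) + (x + z)) + 0.
  rewrite addr0 scalerA mulNr -expr2 sqrCi opprK scale1r addrACA addNr addr0.
  by rewrite -mulr2n -(scaler_nat 2 x) scalerA mulVf ?scale1r// pnatr_eq0.
rewrite !(predual_sa_linear phi) !(predual_sa_linear psi) !predual_sa0.
by rewrite (eqs _ hh) (eqs _ kk).
Qed.

HB.instance Definition _ := Order.Le_isPOrder.Build ring_display predual_sa
  predual_sa_le_refl predual_sa_le_anti predual_sa_le_trans.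

End Predual.

Arguments predual_sa_continuous {R H M} phi x.

(* Main.v *)
(** Call the cost of a representation phi(x) = sum_n <x xi_n, eta_n> (x
    self-adjoint) the number sum_n (|xi_n|^2 + |eta_n|^2) / 2, and let the
    projective norm of phi be the infimum of its costs. By Hahn-Banach there is
    a linear F dominated by the projective norm with F phi equal to that norm;
    applying F to the rank one functionals gives a bounded sesquilinear form,
    hence an operator, which lies in the unit ball of M by the bicommutant
    property. So the projective norm is at most the dual norm. Consequently
    (1) a series of functionals with summable norms can be represented by
    concatenating cheap representations, so the predual is complete, and (2) by
    <x xi, eta> <= (<x xi, xi> + <x eta, eta>) / 2 every hermitian phi lies
    between -psi and psi for some psi with |psi| <= C |phi|.
    As |phi| <= 2 phi(1) for phi >= 0, (1) makes bounded monotone nets converge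
    in norm, so order convergence implies norm convergence. By (1) and (2), a
    sequence converging in norm at the rate 2^-n is squeezed between
    monotone sequences, so it order converges. *)

Require Import Defs.
From mathcomp Require Import all_boot all_order all_algebra.
From mathcomp Require Import all_classical all_reals all_analysis.
From mathcomp Require Import complex ring lra.
Import numFieldNormedType.Exports.
Set Implicit Arguments.
Unset Strict Implicit.
Unset Printing Implicit Defensive.
Import Order.TTheory GRing.Theory Num.Theory.
Local Open Scope classical_set_scope.
Local Open Scope ring_scope.

Local Notation Re := complex.Re.
Local Notation Im := complex.Im.
Local Notation normc := ComplexField.Normc.normc.

(** * The Hahn-Banach theorem for sublinear functionals *)

Section HahnBanach.
Context {R : realType} {V : lmodType R}.
Implicit Types (p q : V -> R) (x y : V).

Definition sublinear p :=
  (forall x y, p (x + y) <= p x + p y) /\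
  (forall t x, 0 <= t -> p (t *: x) <= t * p x).

Lemma sublinear0 p : sublinear p -> p 0 = 0.
Proof.
move=> [pD pZ]; apply/eqP; rewrite eq_le.
have := pZ 0 0 (lexx _); rewrite scale0r mul0r => -> /=.
by have := pD 0 0; rewrite addr0; lra.
Qed.

Lemma sublinearZ p t x : sublinear p -> 0 <= t -> p (t *: x) = t * p x.
Proof.
move=> sp; rewrite le_eqVlt => /predU1P[<-|t0].
  by rewrite scale0r mul0r sublinear0.
apply/eqP; rewrite eq_le (sp.2 _ _ (ltW t0)) /= mulrC -ler_pdivlMr// mulrC.
rewrite -[X in p X <= _](scalerK (lt0r_neq0 t0)); apply: sp.2.
by rewrite invr_ge0 ltW.
Qed.

Lemma sublinear_opp p x : sublinear p -> - p (- x) <= p x.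
Proof.
move=> sp; have := sp.1 x (- x).
by rewrite subrr (sublinear0 sp); lra.
Qed.

(** The term [t = 0] keeps the descent below [p], and the term [t = 1] at [- y] makes it at most
    [- p y]. A linear functional below the descent therefore takes at [y] a value of at least
    [p y]. *)
Definition sublinear_descent p y x :=
  inf [set p (x + t *: y) - t * p y | t in [set t | 0 <= t]].

Lemma sublinear_descent_le p y x t : sublinear p -> 0 <= t ->
  sublinear_descent p y x <= p (x + t *: y) - t * p y.
Proof.
move=> sp t0; apply: ge_inf; last by exists t.
(* Since [s * p y = p (s *: y) <= p (x + s *: y) + p (- x)], the set is bounded below and its
   infimum is genuine. *)
exists (- p (- x)) => _ [s /= s0 <-].
have := sp.1 (x + s *: y) (- x).
by rewrite addrAC subrr add0r sublinearZ//; lra.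
Qed.

Lemma le_sublinear_descent p y x (c : R) :
  (forall t, 0 <= t -> c <= p (x + t *: y) - t * p y) ->
  c <= sublinear_descent p y x.
Proof.
move=> cp; apply: lb_le_inf; last by move=> _ [t t0 <-]; exact: cp.
by exists (p (x + 0 *: y) - 0 * p y), 0 => /=.
Qed.

Lemma sublinear_descent_sublinear p y :
  sublinear p -> sublinear (sublinear_descent p y).
Proof.
move=> sp; split=> [x z|t x].
  rewrite -lerBlDr; apply: le_sublinear_descent => t t0.
  rewrite lerBlDr -lerBlDl; apply: le_sublinear_descent => s s0.
  rewrite lerBlDl.
  apply: le_trans (sublinear_descent_le _ _ sp (addr_ge0 t0 s0)) _.
  rewrite scalerDl addrACA.
  by have := sp.1 (x + t *: y) (z + s *: y); lra.
rewrite le_eqVlt => /predU1P[<-|t0].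
  rewrite scale0r mul0r.
  apply: le_trans (sublinear_descent_le _ _ sp (lexx 0)) _.
  by rewrite scale0r addr0 mul0r subr0 sublinear0.
rewrite mulrC -ler_pdivrMr//; apply: le_sublinear_descent => s s0.
rewrite ler_pdivrMr//.
apply: le_trans (sublinear_descent_le _ _ sp (mulr_ge0 (ltW t0) s0)) _.
by rewrite -scalerA -scalerDr (sublinearZ _ sp (ltW t0)); lra.
Qed.

(* A sublinear functional that is minimal for the pointwise order coincides
   with all its descents, which forces it to be additive. *)
Lemma sublinear_minimal p : sublinear p ->
  exists2 q, sublinear q /\ (forall x, q x <= p x) &
    forall x y, q (x + y) = q x + q y.
Proof.
move=> sp; pose T := {q | sublinear q /\ forall x, q x <= p x}.
(* The order is reversed: a maximal element for [Zorn] is pointwise minimal. *)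
pose le (f g : T) := `[< forall x, sval g x <= sval f x >].
have [|f g h /asboolP fg /asboolP gh|f g /asboolP fg /asboolP gf|A Atot|]
    := @Zorn T le.
- by move=> f; apply/asboolP.
- by apply/asboolP => x; exact: le_trans (gh x) (fg x).
- apply: eq_sig_hprop => [*|]; first exact: Prop_irrelevance.
  apply/funext => x; apply/eqP.
  by rewrite eq_le gf fg.
- have [[f0 Af0]|A0] := pselect (exists f, A f); last first.
    by exists (exist _ p (conj sp (fun x => lexx _))) => f Af; case: A0; exists f.
  pose m x := inf [set sval f x | f in A].
  have mle f x : A f -> m x <= sval f x.
    move=> Af; apply: ge_inf; last by exists f.
    exists (- p (- x)) => _ [g Ag <-].
    apply: le_trans (sublinear_opp x (svalP g).1).
    by rewrite lerN2 (svalP g).2.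
  have lem x c : (forall f, A f -> c <= sval f x) -> c <= m x.
    move=> cA; apply: lb_le_inf; first by exists (sval f0 x), f0.
    by move=> _ [f Af <-]; exact: cA.
  have sm : sublinear m.
    split=> [x y|t x].
      rewrite -lerBlDr; apply: (lem) => f Af.
      rewrite lerBlDr -lerBlDl; apply: (lem) => g Ag; rewrite lerBlDl.
      (* The smaller of [f] and [g] serves as the bound at both points; this is where totality of
         the chain enters. *)
      have [/asboolP fg|/asboolP gf] := Atot _ _ Af Ag.
        apply: le_trans (mle _ _ Ag) _; apply: le_trans ((svalP g).1.1 x y) _.
        by rewrite lerD2r.
      apply: le_trans (mle _ _ Af) _; apply: le_trans ((svalP f).1.1 x y) _.
      by rewrite lerD2l.
    rewrite le_eqVlt => /predU1P[<-|t0].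
      apply: le_trans (mle _ _ Af0) _.
      by rewrite scale0r mul0r sublinear0//; exact: (svalP f0).1.
    rewrite -ler_pdivrMl//; apply: (lem) => f Af.
    rewrite ler_pdivrMl//; apply: le_trans (mle _ _ Af) _.
    by apply: (svalP f).1.2; exact: ltW.
  have mp x : m x <= p x by apply: le_trans (mle _ x Af0) ((svalP f0).2 x).
  by exists (exist _ m (conj sm mp)) => f Af; apply/asboolP => x; exact: mle.
move=> [q [sq qp]] qmin; exists q => // x y.
have sd := sublinear_descent_sublinear y sq.
have dle z : sublinear_descent q y z <= q z.
  apply: le_trans (sublinear_descent_le _ _ sq (lexx 0)) _.
  by rewrite scale0r addr0 mul0r subr0.
have dp z : sublinear_descent q y z <= p z by apply: le_trans (dle z) (qp z).
(* By minimality [q] equals its own descent along [y], and the term [t = 1] gives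
   [q x + q y <= q (x + y)]. *)
have := qmin (exist _ _ (conj sd dp)).
rewrite /le => /(_ (introT (asboolP _) dle)) /(congr1 sval) /= dq.
apply/eqP; rewrite eq_le sq.1 /= -lerBrDr -[X in X <= _](congr1 (@^~ x) dq).
apply: le_trans (sublinear_descent_le _ _ sq ler01) _.
by rewrite scale1r mul1r.
Qed.

(** An additive sublinear functional below the descent of [p] along [y] does the job: homogeneity
    for negative scalars follows from additivity, and the value at [- y] forces equality at [y]. *)
Theorem hahn_banach p y : sublinear p ->
  exists F : V -> R, [/\ forall x z, F (x + z) = F x + F z,
    forall t x, F (t *: x) = t * F x,
    forall x, F x <= p x & F y = p y].
Proof.
move=> sp; have sd := sublinear_descent_sublinear y sp.
have [F [sF Fle] FD] := sublinear_minimal sd.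
have dle z : sublinear_descent p y z <= p z.
  apply: le_trans (sublinear_descent_le _ _ sp (lexx 0)) _.
  by rewrite scale0r addr0 mul0r subr0.
have FN x : F (- x) = - F x.
  by apply/eqP; rewrite -addr_eq0 -FD addNr sublinear0.
exists F; split=> // [t x|x|].
- have [t0|/ltW t0] := leP 0 t; first exact: sublinearZ.
  by apply: oppr_inj; rewrite -FN -scaleNr sublinearZ ?mulNr// oppr_ge0.
- exact: le_trans (Fle x) (dle x).
apply/eqP; rewrite eq_le (le_trans (Fle y) (dle y)) /= -lerN2 -FN.
apply: le_trans (Fle _) _.
apply: le_trans (sublinear_descent_le _ _ sp ler01) _.
by rewrite scale1r addNr mul1r sublinear0// sub0r.
Qed.

End HahnBanach.

(** * Rearrangement of double series *)

Section DoubleSeries.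
Context {R : realType}.
Implicit Types (u v : nat -> R) (e : nat -> nat * nat).

Lemma bounded_series_cvg u (K : R) : (forall n, 0 <= u n) ->
  (forall n, series u n <= K) -> cvgn (series u).
Proof.
move=> u0 uK; apply: nondecreasing_is_cvgn.
  by apply/nondecreasing_seqP => n; rewrite /series /= big_nat_recr//= lerDl.
by exists K => _ [n _ <-]; exact: uK.
Qed.

Lemma dominated_series_cvg u v (K : R) : (forall n, `|u n| <= v n) ->
  (forall n, series v n <= K) -> cvgn (series u).
Proof.
move=> uv vK; apply: normed_cvg; apply: (@bounded_series_cvg _ K) => [n|n].
  exact: normr_ge0.
by apply: le_trans (vK n); apply: ler_sum => i _; exact: uv.
Qed.

(** Passing to the extended reals allows nonnegative double sums to be rearranged freely, without
    convergence conditions. *)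
Lemma cvg_series_nneseries u (l : R) : (forall n, 0 <= u n) ->
  series u @ \oo --> l <-> (\sum_(i <oo) (u i)%:E = l%:E)%E.
Proof.
move=> u0; have sE : (fun n => \sum_(0 <= i < n) (u i)%:E)%E = EFin \o series u.
  by apply/funext => n; rewrite sumEFin.
split=> [ul|].
  rewrite [LHS](_ : _ = limn (EFin \o series u)); last by rewrite sE.
  by apply: cvg_lim => //; exact: cvg_comp ul _.
have uc : cvgn (fun n => \sum_(0 <= i < n) (u i)%:E)%E.
  by apply: is_cvg_nneseries => n _ _; rewrite lee_fin.
move=> ul; have /fine_cvg : (fun n => \sum_(0 <= i < n) (u i)%:E)%E @ \oo --> l%:E.
  by rewrite -ul.
by rewrite sE.
Qed.

Lemma nneseries_pair e (f : nat * nat -> R) : set_bij setT setT e ->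
  (forall p, 0 <= f p) ->
  (\sum_(m <oo) (f (e m))%:E = \sum_(k <oo) \sum_(n <oo) (f (k, n))%:E)%E.
Proof.
move=> eb f0; rewrite nneseries_esumT; last by move=> n; rewrite lee_fin.
rewrite -(@reindex_esum _ _ _ _ _ e (fun p => (f p)%:E) eb).
rewrite nneseries_esumT; last first.
  by move=> n; apply: nneseries_ge0 => *; rewrite lee_fin.
transitivity (\esum_(k in [set: nat]) \esum_(n in [set: nat]) (f (k, n))%:E)%E;
  last first.
  by apply: eq_esum => k _; rewrite nneseries_esumT// => n; rewrite lee_fin.
rewrite esum_esum; last by move=> *; rewrite lee_fin.
have -> : setT `*`` (fun=> setT) = [set: nat * nat] by apply/seteqP.
by apply: eq_esum => -[].
Qed.

Lemma double_series_bound e (f : nat * nat -> R) (s : nat -> R) (L : R) :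
  set_bij setT setT e -> (forall p, 0 <= f p) ->
  (forall k n, series (fun n => f (k, n)) n <= s k) ->
  (forall n, series s n <= L) ->
  forall n, series (f \o e) n <= L.
Proof.
move=> eb f0 fs sL n; rewrite -lee_fin /series /= -sumEFin.
apply: (@le_trans _ _ (\sum_(m <oo) (f (e m))%:E)%E).
  by apply: nneseries_lim_ge => *; rewrite lee_fin.
rewrite nneseries_pair//.
have s0 k : 0 <= s k by apply: (le_trans _ (fs k 0%N)); rewrite /series /= big_nil.
apply: (@le_trans _ _ (\sum_(k <oo) (s k)%:E)%E).
  apply: lee_nneseries => [k _ _|k _].
    by apply: nneseries_ge0 => *; rewrite lee_fin.
  apply: lime_le => [|]; first by apply: is_cvg_nneseries => *; rewrite lee_fin.
  by apply: nearW => m; rewrite sumEFin lee_fin; exact: fs.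
apply: lime_le => [|]; first by apply: is_cvg_nneseries => *; rewrite lee_fin.
by apply: nearW => m; rewrite sumEFin lee_fin; exact: sL.
Qed.

(** Adding the summable majorant [K * c] makes the terms nonnegative; the nonnegative case is
    applied to [r + K * c] and to [K * c], and the results are subtracted. *)
Lemma double_series_cvg e (r c : nat * nat -> R) (b s : nat -> R) (K L l : R) :
  set_bij setT setT e ->
  (forall p, `|r p| <= K * c p) -> 0 <= K -> (forall p, 0 <= c p) ->
  (forall k n, series (fun n => c (k, n)) n <= b k) ->
  (forall n, series b n <= L) ->
  (forall k, series (fun n => r (k, n)) @ \oo --> s k) ->
  series (r \o e) @ \oo --> l -> series s @ \oo --> l.
Proof.
move=> eb rc K0 c0 cb bL rs rl.
have nn (f : nat * nat -> R) (t : nat -> R) (l' : R) : (forall p, 0 <= f p) ->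
    (forall k, series (fun n => f (k, n)) @ \oo --> t k) ->
    series (f \o e) @ \oo --> l' -> series t @ \oo --> l'.
  move=> f0 ft fl.
  have t0 k : 0 <= t k.
    rewrite -lee_fin -((cvg_series_nneseries _ _).1 (ft k)) //.
    by apply: nneseries_ge0 => *; rewrite lee_fin.
  apply/cvg_series_nneseries => //.
  rewrite -((cvg_series_nneseries _ _).1 fl); last first.
    by move=> m; exact: f0.
  rewrite /= nneseries_pair//; apply: eq_eseriesr => k _.
  by apply/esym/cvg_series_nneseries.
pose g p := K * c p.
have g0 p : 0 <= g p by rewrite mulr_ge0.
have gc k : cvgn (series (fun n => g (k, n))).
  apply: (@bounded_series_cvg _ (K * b k)) => // n.
  by rewrite /series /= -mulr_sumr ler_wpM2l//; exact: cb.
have gec : cvgn (series (g \o e)).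
  apply: (@bounded_series_cvg _ (K * L)) => [n|n]; first exact: g0.
  rewrite /series /= -mulr_sumr ler_wpM2l//.
  exact: (double_series_bound eb c0 cb bL).
pose t k := limn (series (fun n => g (k, n))).
have gt := nn g t _ g0 gc gec.
have serD (u v : nat -> R) (x y : R) : series u @ \oo --> x ->
    series v @ \oo --> y -> series (u \+ v) @ \oo --> x + y.
  by move=> ux vy; rewrite seriesD; exact: cvgD.
have rg : series (s \+ t) @ \oo --> l + limn (series (g \o e)).
  apply: (nn (r \+ g)) => [p|k|].
  - by have := rc p; rewrite ler_norml /= /g => /andP[+ _]; lra.
  - by apply: serD => //; exact: gc.
  - exact: serD.
have -> : s = (s \+ t) - t by apply/funext => k; apply/esym/addrK.
rewrite -[l](addrK (limn (series (g \o e)))) seriesD seriesN.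
by apply: cvgB.
Qed.

End DoubleSeries.

(** * Real parts, and the real inner product of a complex Hilbert space *)

Section ComplexParts.
Context {R : realType}.
Implicit Types (z w : R[i]) (a : R).

Lemma ReD z w : Re (z + w) = Re z + Re w. Proof. by case: z; case: w. Qed.
Lemma ReN z : Re (- z) = - Re z. Proof. by case: z. Qed.
Lemma ReB z w : Re (z - w) = Re z - Re w. Proof. by rewrite ReD ReN. Qed.
Lemma ReZ a z : Re (a%:C%C * z) = a * Re z.
Proof. by case: z => x y /=; rewrite mul0r subr0. Qed.
Lemma Re_conj z : Re z^*%R = Re z.
Proof. by apply: complexI; rewrite !complexRe Num.Theory.Re_conj. Qed.
Lemma Re_i z : Re ('i * z) = - Im z.
Proof. by rewrite -complexiE; case: z => x y /=; rewrite mul0r mul1r sub0r. Qed.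
Lemma Re_ge0 z : 0 <= z -> 0 <= Re z.
Proof. by rewrite lecE => /andP[]. Qed.
Lemma normr_Re z : `|Re z| <= ComplexField.Normc.normc z.
Proof. by rewrite -lecR; exact: normc_ge_Re. Qed.
Lemma Re_sum (I : Type) (r : seq I) (f : I -> R[i]) :
  Re (\sum_(i <- r) f i) = \sum_(i <- r) Re (f i).
Proof. by elim/big_rec2: _ => // i x y _ <-; rewrite ReD. Qed.

End ComplexParts.

Lemma cvg_dist_le {R : realType} (f g : nat -> R) (l : R) :
  (forall n, `|f n - l| <= g n) -> g @ \oo --> (0 : R) -> f @ \oo --> l.
Proof.
move=> fg g0; apply/subr_cvg0; apply/cvgr0Pnorm_lt => e e0.
have [N _ NP] := cvgr0_norm_lt _ g0 _ e0.
exists N => // n Nn; apply: le_lt_trans (fg n) _.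
exact: le_lt_trans (ler_norm _) (NP n Nn).
Qed.

Section RealStructure.
Context {R : realType} {H : hilbertSpace R}.
Implicit Types (u v w : H) (a t : R).

(* Norm and real part of the inner product as elements of R; scaling by t : R
   is written t%:C *: u, as H is only a module over R[i]. *)
Definition nrm u : R := Re `|u|.
Definition ip u v : R := Re (inner u v).

Lemma nrmE u : `|u| = (nrm u)%:C%C.
Proof. by rewrite RRe_real// normr_real. Qed.
Lemma nrm_ge0 u : 0 <= nrm u.
Proof. by rewrite -lecR -nrmE; exact: normr_ge0. Qed.
Lemma ipDl u v w : ip (u + v) w = ip u w + ip v w.
Proof. by rewrite /ip innerDl ReD. Qed.
Lemma ipDr u v w : ip u (v + w) = ip u v + ip u w.
Proof. by rewrite /ip innerDr ReD. Qed.
Lemma ipZl a u v : ip (a%:C%C *: u) v = a * ip u v.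
Proof. by rewrite /ip innerZl ReZ. Qed.
Lemma ipC u v : ip u v = ip v u.
Proof. by rewrite /ip innerC Re_conj. Qed.
Lemma ipZr a u v : ip u (a%:C%C *: v) = a * ip u v.
Proof. by rewrite ipC ipZl ipC. Qed.
Lemma ipNl u v : ip (- u) v = - ip u v.
Proof. by rewrite -[- u]scaleN1r -(rmorphN1 (real_complex R)) ipZl mulN1r. Qed.
Lemma ipNr u v : ip u (- v) = - ip u v.
Proof. by rewrite ipC ipNl ipC. Qed.
Lemma ip_nrm u : ip u u = nrm u ^+ 2.
Proof. by rewrite /ip inner_norm nrmE -rmorphXn. Qed.
Lemma ip_i u v : ip ('i *: u) v = ip u (- ('i *: v)).
Proof. by rewrite ipNr /ip innerZl innerZr conjCi mulNr ReN opprK. Qed.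
Lemma ip_Im u v : ip ('i *: u) v = - Im (inner u v).
Proof. by rewrite /ip innerZl Re_i. Qed.
Lemma ip_le u v : `|ip u v| <= nrm u * nrm v.
Proof.
apply: le_trans (normr_Re _) _; rewrite -lecR rmorphM /= -!nrmE.
exact: inner_CauchySchwarz.
Qed.
Lemma nrm0 : nrm (0 : H) = 0. Proof. by rewrite /nrm normr0. Qed.
Lemma ip_ext u v : (forall w, ip u w = ip v w) -> u = v.
Proof.
move=> uv; apply/eqP; rewrite -subr_eq0 -normr_eq0 nrmE.
suff -> : nrm (u - v) = 0 by [].
by apply/eqP; rewrite -sqrf_eq0 -ip_nrm ipDl ipNl uv subrr.
Qed.
Lemma nrmZ a u : nrm (a%:C%C *: u) = `|a| * nrm u.
Proof.
by rewrite /nrm normrZ nrmE normc_def /= expr0n /= addr0 sqrtr_sqr mulr0 subr0.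
Qed.
Lemma nrmN u : nrm (- u) = nrm u. Proof. by rewrite /nrm normrN. Qed.
Lemma nrm_i u : nrm ('i *: u) = nrm u.
Proof. by rewrite /nrm normrZ normCi mul1r. Qed.

Lemma nrm_cauchy_cvg (x : nat -> H) :
  (forall e, 0 < e -> exists N, forall m n, (N <= m)%N -> (N <= n)%N ->
     nrm (x m - x n) < e) ->
  exists v, (fun n => nrm (x n - v)) @ \oo --> (0 : R).
Proof.
move=> xC; have /cauchy_cvgP : cauchy (x @ \oo).
  apply/cauchy_ballP => e e0.
  have /complex_realP[e' eE] := gtr0_real e0.
  have [|N NP] := xC e'; first by rewrite -ltcR -eE.
  exists (x @` [set m | (N <= m)%N], x @` [set m | (N <= m)%N]).
    by split; exists N => // m Nm; exists m.
  move=> [_ _] [/= [m Nm <-] [n Nn <-]]; rewrite -ball_normE /ball_ /= eE nrmE ltcR.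
  exact: NP.
move=> xv; exists (lim (x @ \oo)); apply/cvgr0Pnorm_lt => e e0.
have e0' : 0 < e%:C%C by rewrite ltcR.
have [N _ NP] := @cvgr_dist_lt _ _ _ _ _ x (lim (x @ \oo)) xv _ e0'.
exists N => // n Nn /=; rewrite ger0_norm ?nrm_ge0// -ltcR -nrmE distrC.
exact: NP.
Qed.

Lemma cvg_ip (x : nat -> H) v w :
  (fun n => nrm (x n - v)) @ \oo --> (0 : R) ->
  (fun n => ip (x n) w) @ \oo --> ip v w.
Proof.
move=> xv; apply: (@cvg_dist_le _ _ (fun n => nrm (x n - v) * nrm w)).
  by move=> n; have := ip_le (x n - v) w; rewrite ipDl ipNl.
by rewrite -(mul0r (nrm w)); apply: cvgM => //; exact: cvg_cst.
Qed.

End RealStructure.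

(** * Riesz representation, operators of bounded forms, adjoints *)

Section Riesz.
Context {R : realType} {H : hilbertSpace R}.
Implicit Types (u v w : H) (a t : R).

Lemma nrmD2 u v : nrm (u + v) ^+ 2 = nrm u ^+ 2 + 2 * ip u v + nrm v ^+ 2.
Proof. by rewrite -!ip_nrm !ipDl !ipDr (ipC v u); ring. Qed.

(* The representing vector minimizes u |-> |u|^2 - 2 g u. *)
Lemma riesz (g : H -> R) (k : R) :
  (forall u v, g (u + v) = g u + g v) ->
  (forall t u, g (t%:C%C *: u) = t * g u) ->
  (forall u, `|g u| <= k * nrm u) -> exists v, forall u, g u = ip v u.
Proof.
move=> gD gZ gk; pose J u := nrm u ^+ 2 - 2 * g u.
have JD u h t : J (u + t%:C%C *: h) =
    J u + t ^+ 2 * nrm h ^+ 2 + 2 * t * (ip u h - g h).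
  rewrite /J nrmD2 nrmZ gD gZ ipZr exprMn -normrX ger0_norm ?sqr_ge0//; ring.
have Jk u : - k ^+ 2 <= J u.
  have : 0 <= (nrm u - k) ^+ 2 by exact: sqr_ge0.
  have := gk u; rewrite ler_norml /J => /andP[_]; lra.
have Jinf : has_inf (range J).
  by split; [exists (J 0), 0|exists (- k ^+ 2) => _ [u _ <-]].
pose m := inf (range J).
have mJ u : m <= J u by apply: ge_inf; [exact: Jinf.2|exists u].
have /choice[x xP] : forall n : nat, exists u, J u < m + n.+1%:R^-1.
  move=> n; have n0 : 0 < n.+1%:R^-1 :> R by rewrite invr_gt0.
  by have [_ [u _ <-] Ju] := inf_adherent n0 Jinf; exists u.
(* Parallelogram law, with [J >= m] at the midpoint: a minimizing sequence is Cauchy. *)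
have par u v : nrm (u - v) ^+ 2 <= 2 * (J u - m) + 2 * (J v - m).
  have := mJ ((2^-1)%:C%C *: (u + v)).
  rewrite /J nrmZ gZ gD exprMn -normrX ger0_norm ?sqr_ge0// !nrmD2 nrmN ipNr.
  rewrite expr2; lra.
have [|v xv] := @nrm_cauchy_cvg _ _ x.
  move=> e e0; have e20 : 0 < e ^+ 2 / 4 by rewrite divr_gt0// exprn_gt0.
  exists (Num.bound (e ^+ 2 / 4)^-1) => i j Ni Nj.
  have Jx n : (Num.bound (e ^+ 2 / 4)^-1 <= n)%N -> J (x n) < m + e ^+ 2 / 4.
    move=> Nn; apply: lt_trans (xP n) _; rewrite ltrD2l invf_plt ?posrE//.
    apply: lt_le_trans (archi_boundP _) _; first by rewrite invr_ge0 ltW.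
    by rewrite ler_nat (leq_trans Nn).
  rewrite -(@ltr_pXn2r _ 2)// ?nnegrE ?nrm_ge0 ?ltW//.
  apply: le_lt_trans (par _ _) _.
  by have := Jx _ Ni; have := Jx _ Nj; lra.
(* First variation at the limit [v], obtained by letting [n] grow in the inequality
   [m <= J (x n + t h)], so that [J v] itself is never evaluated. *)
have key h t : 0 <= t ^+ 2 * nrm h ^+ 2 + 2 * t * (ip v h - g h).
  have lim1 : (fun n => t ^+ 2 * nrm h ^+ 2 + 2 * t * (ip (x n) h - g h) +
      n.+1%:R^-1) @ \oo --> t ^+ 2 * nrm h ^+ 2 + 2 * t * (ip v h - g h) + 0.
    apply: cvgD; last exact: cvg_harmonic.
    apply: cvgD; first exact: cvg_cst.
    apply: cvgM; first exact: cvg_cst.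
    by apply: cvgB; [exact: cvg_ip|exact: cvg_cst].
  rewrite -[leRHS]addr0; apply: (cvgr_to_ge lim1); apply: nearW => n.
  have := mJ (x n + t%:C%C *: h); rewrite JD /=.
  by move: (xP n); move: (_^-1) => e; lra.
exists v => h; apply/eqP; rewrite eq_sym -subr_eq0; apply/eqP.
(* At [t = - d * s] the quadratic equals [- s (1 + s) d ^+ 2], which can be nonnegative only if
   [d = 0]; the [+ 1] covers [h = 0]. *)
set d := _ - _; pose N := nrm h ^+ 2; pose s := (N + 1)^-1.
have N0 : 0 <= N by exact: sqr_ge0.
have s0 : 0 < s by rewrite invr_gt0; lra.
have sN : s * (N + 1) = 1 by rewrite mulVf//; lra.
have := key h (- d * s); rewrite -/d -/N.
have -> : (- d * s) ^+ 2 * N + 2 * (- d * s) * d = - (s * (1 + s) * d ^+ 2).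
  have -> : N = s^-1 - 1 by rewrite /s invrK; lra.
  by field; lra.
rewrite oppr_ge0 pmulr_rle0; last by rewrite mulr_gt0//; lra.
by move=> d2; apply/eqP; rewrite -sqrf_eq0 eq_le d2 sqr_ge0.
Qed.

Lemma bounded_op_of_bound (x : H -> H) (k : R) : linear x ->
  (forall u, nrm (x u) <= k * nrm u) -> bounded_op x.
Proof.
move=> xl xk; split=> // u; apply/cvgrPdist_lt => e e0.
have /complex_realP[e' eE] := gtr0_real e0.
have e'0 : 0 < e' by rewrite -ltcR -eE.
pose K := `|k| + 1; have K0 : 0 < K by rewrite ltr_wpDl.
have d0 : 0 < (e' / K)%:C%C by rewrite ltcR divr_gt0.
have := nbhsx_ballx u _ d0.
apply: filterS => v; rewrite -ball_normE /ball_ /= nrmE ltcR ltr_pdivlMr// => uv.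
have -> : x u - x v = x (u - v).
  by have := xl (-1) v u; rewrite !scaleN1r addrC => <-; rewrite addrC.
rewrite nrmE eE ltcR; apply: le_lt_trans uv; apply: le_trans (xk _) _.
rewrite mulrC ler_wpM2l ?nrm_ge0//; apply: le_trans (ler_norm _) _.
by rewrite lerDl.
Qed.

(** Riesz is applied in the second variable for each [u]. The form is only real bilinear; its
    compatibility with ['i] is what makes the resulting operator complex linear. *)
Lemma op_of_form (G : H -> H -> R) (k : R) :
  (forall u v w, G (u + v) w = G u w + G v w) ->
  (forall u v w, G u (v + w) = G u v + G u w) ->
  (forall t u v, G (t%:C%C *: u) v = t * G u v) ->
  (forall t u v, G u (t%:C%C *: v) = t * G u v) ->
  (forall u v, G ('i *: u) v = G u (- ('i *: v))) ->
  (forall u v, `|G u v| <= k * nrm u * nrm v) ->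
  exists x : H -> H, bounded_op x /\ forall u v, G u v = ip (x u) v.
Proof.
move=> GDl GDr GZl GZr Gi Gk.
have /choice[x xP] u := riesz (GDr u) (fun t v => GZr t u v) (Gk u).
exists x; split=> //; apply: (@bounded_op_of_bound _ `|k|) => [c u v|u].
  apply: ip_ext => w; rewrite -xP GDl ipDl -xP; congr (_ + _).
  rewrite (complexE c) complexiE !scalerDl -!scalerA ipDl GDl ipZl GZl -xP.
  by rewrite ip_i Gi ipZl GZl -xP.
have [->|] := eqVneq (nrm (x u)) 0; first by rewrite mulr_ge0 ?nrm_ge0.
move=> x0; have {}x0 : 0 < nrm (x u) by rewrite lt_def x0 nrm_ge0.
rewrite -(ler_pM2r x0) -expr2 -ip_nrm -xP.
apply: le_trans (ler_norm _) _; apply: le_trans (Gk _ _) _.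
by rewrite ler_wpM2r ?nrm_ge0// ler_wpM2r ?nrm_ge0// ler_norm.
Qed.

Lemma adjoint_exists (x : H -> H) : bounded_op x ->
  exists y : H -> H, forall u v, ip (x u) v = ip u (y v).
Proof.
move=> bx; have [k k0 xk] := bounded_op_bound bx.
have /complex_realP[k' kE] := ger0_real k0.
have xl := bounded_op_lin bx.
have xD u v : x (u + v) = x u + x v.
  by have := xl 1 u v; rewrite !scale1r.
have xZ c u : x (c *: u) = c *: x u.
  by have := xl c u 0; rewrite !addr0 (bounded_op0 bx) addr0.
have [| | | | | |y [_ yP]] := @op_of_form (fun v u => ip v (x u)) k'.
- by move=> u v w; rewrite ipDl.
- by move=> u v w; rewrite xD ipDr.
- by move=> t u v; rewrite ipZl.
- by move=> t u v; rewrite xZ ipZr.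
- by move=> u v; rewrite ip_i -!scaleNr xZ.
- move=> u v; apply: le_trans (ip_le _ _) _; rewrite -mulrA mulrCA.
  rewrite ler_wpM2l ?nrm_ge0//.
  by have := xk v; rewrite !nrmE kE -rmorphM /= lecR.
by exists y => u v; rewrite [RHS]ipC -yP ipC.
Qed.

End Riesz.

(** * Complex limits through real and imaginary parts *)

Section ComplexLimits.
Context {R : realType}.
Implicit Types (s : nat -> R[i]^o).

Lemma cvg_real_complex (s : nat -> R) (l : R) :
  s @ \oo --> l -> (fun n => (s n)%:C%C : R[i]^o) @ \oo --> (l%:C%C : R[i]^o).
Proof.
move=> sl; apply/cvgrPdist_lt => e e0.
have /complex_realP[e' eE] := gtr0_real e0.
have e'0 : 0 < e' by rewrite -ltcR -eE.
move/cvgrPdist_lt : sl => /(_ _ e'0).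
apply: filterS => n; rewrite -ltcR -eE -rmorphB normc_def /= expr0n /= addr0.
by rewrite sqrtr_sqr.
Qed.

Lemma cvg_Re s (l : R[i]) : s @ \oo --> (l : R[i]^o) ->
  (fun n => Re (s n)) @ \oo --> Re l.
Proof.
move=> sl; apply/cvgrPdist_lt => e e0.
have e'0 : 0 < e%:C%C by rewrite ltcR.
move/cvgrPdist_lt : sl => /(_ _ e'0).
apply: filterS => n; rewrite -ltcR -ReB; apply: le_lt_trans.
exact: normc_ge_Re.
Qed.

Lemma cvgn_complex s : cvgn (fun n => Re (s n)) -> cvgn (fun n => Im (s n)) ->
  cvgn s.
Proof.
move=> /cvg_real_complex rs /cvg_real_complex ims.
have -> : s = (fun n => (Re (s n))%:C%C : R[i]^o) \+
    (cst ('i : R[i]^o) \* (fun n => (Im (s n))%:C%C : R[i]^o)).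
  by apply/funext => n; rewrite {1}(complexE (s n)).
apply/cvg_ex; eexists; apply: cvgD rs _.
by apply: cvgM ims; exact: cvg_cst.
Qed.

End ComplexLimits.

Lemma Im_sum {R : realType} (I : Type) (r : seq I) (f : I -> R[i]) :
  Im (\sum_(i <- r) f i) = \sum_(i <- r) Im (f i).
Proof. by elim/big_rec2: _ => // i x y _ <-; case: y (f i) => ? ? []. Qed.

Lemma Im_inner {R : realType} {H : hilbertSpace R} (u v : H) :
  Im (inner u v) = ip u ('i *: v).
Proof. by apply: oppr_inj; rewrite -ip_Im ip_i ipNr. Qed.

(** * Functionals given by sequences of vectors *)

Section VectorFunctionals.
Context {R : realType} {H : hilbertSpace R} (M : vonNeumannAlgebra H).
Implicit Types (xi eta : nat -> H) (x : vn_sort M) (phi : predual_sa M).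

(** The mean of squares dominates the product of the norms, and a bound on its partial sums also
    makes both sequences square summable. *)
Definition cost xi eta (n : nat) : R := (nrm (xi n) ^+ 2 + nrm (eta n) ^+ 2) / 2.

Lemma cost_ge0 xi eta n : 0 <= cost xi eta n.
Proof. by rewrite /cost divr_ge0// addr_ge0// sqr_ge0. Qed.

Lemma vn_op_bound x : exists2 c : R, 0 <= c & forall u, nrm (val x u) <= c * nrm u.
Proof.
have [k k0 xk] := bounded_op_bound (vn_bounded (set_mem (valP x))).
have /complex_realP[k' kE] := ger0_real k0.
exists k'; first by rewrite -lecR -kE.
by move=> u; have := xk u; rewrite !nrmE kE -rmorphM /= lecR.
Qed.

Lemma ip_cost x (c : R) xi eta n : 0 <= c ->
  (forall u, nrm (val x u) <= c * nrm u) ->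
  `|ip (val x (xi n)) (eta n)| <= c * cost xi eta n.
Proof.
move=> c0 xc; apply: le_trans (ip_le _ _) _.
apply: (@le_trans _ _ (c * (nrm (xi n) * nrm (eta n)))).
  by rewrite mulrA ler_wpM2r ?nrm_ge0.
rewrite ler_wpM2l// /cost.
have := sqr_ge0 (nrm (xi n) - nrm (eta n)); lra.
Qed.

Lemma square_summable_bounded xi (K : R) :
  (forall n, series (fun i => nrm (xi i) ^+ 2) n <= K) -> square_summable xi.
Proof.
move=> xK; have := bounded_series_cvg (fun n => sqr_ge0 (nrm (xi n))) xK.
move=> /cvg_real_complex xc; apply/cvg_ex; eexists.
apply: cvg_trans xc; apply: near_eq_cvg; apply: nearW => n.
rewrite /series /= rmorph_sum /=; apply: eq_bigr => i _.
by rewrite nrmE -rmorphXn.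
Qed.

Lemma ell2_nrm_bound (xi : @ell2 R H) : exists K : R,
  forall n, series (fun i => nrm (sval xi i) ^+ 2) n <= K.
Proof.
have [k k0 kP] := ell2_bound xi.
have /complex_realP[k' kE] := ger0_real k0.
exists k' => n; have := kP n; rewrite kE.
suff -> : \sum_(0 <= i < n) `|sval xi i| ^+ 2 =
    (series (fun i => nrm (sval xi i) ^+ 2) n)%:C%C by rewrite lecR.
rewrite /series /= rmorph_sum /=; apply: eq_bigr => i _.
by rewrite nrmE -rmorphXn.
Qed.

Lemma ell2_cost_bound (p : @ell2 R H * @ell2 R H) : exists K : R,
  forall n, series (cost (sval p.1) (sval p.2)) n <= K.
Proof.
have [K1 K1P] := ell2_nrm_bound p.1; have [K2 K2P] := ell2_nrm_bound p.2.
exists ((K1 + K2) / 2) => n; rewrite /series /= -mulr_suml big_split /=.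
by rewrite ler_wpM2r// lerD// ?K1P ?K2P.
Qed.

Lemma series_ip_cvg xi eta x (K : R) : (forall n, series (cost xi eta) n <= K) ->
  cvgn (series (fun n => ip (val x (xi n)) (eta n))).
Proof.
move=> xK; have [c c0 xc] := vn_op_bound x.
apply: (@dominated_series_cvg _ _ (fun n => c * cost xi eta n) (c * K)) => n.
  exact: ip_cost.
by rewrite /series /= -mulr_sumr ler_wpM2l//; exact: xK.
Qed.

(** [limn] is meaningful only for a convergent sequence. The imaginary part of the series is a real
    series of the same kind, with [eta] replaced by ['i *: eta], which has the same cost. *)
Lemma vector_functional_cvg p x :
  series (fun n => inner (val x (sval p.1 n)) (sval p.2 n))
    @ \oo --> (vector_functional p x : R[i]^o).
Proof.
have [K KP] := ell2_cost_bound p.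
have KPi n : series (cost (sval p.1) (fun n => 'i *: sval p.2 n)) n <= K.
  by apply: le_trans (KP n); apply: ler_sum => i _; rewrite /cost nrm_i.
apply: cvgn_complex.
  rewrite (_ : (fun n => _) =
      series (fun n => ip (val x (sval p.1 n)) (sval p.2 n))).
    exact: series_ip_cvg KP.
  by apply/funext => n; rewrite /series /= Re_sum.
rewrite (_ : (fun n => _) =
    series (fun n => ip (val x (sval p.1 n)) ('i *: sval p.2 n))).
  exact: (series_ip_cvg KPi).
apply/funext => n; rewrite /series /= Im_sum.
by apply: eq_bigr => i _; rewrite Im_inner.
Qed.

End VectorFunctionals.

Section Representation.
Context {R : realType} {H : hilbertSpace R} (M : vonNeumannAlgebra H).
Implicit Types (xi eta : nat -> H) (x : vn_sort M) (phi psi : predual_sa M).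

Definition self_adjoint x := is_adjoint (val x) (val x).


Lemma vector_functional_linear p : linear (@vector_functional R H M p).
Proof.
move=> a x y; apply: cvg_lim => //.
rewrite (_ : series _ = (cst (a : R[i]^o) \*
    series (fun n => inner (val x (sval p.1 n)) (sval p.2 n))) \+
    series (fun n => inner (val y (sval p.1 n)) (sval p.2 n))); last first.
  apply/funext => n; rewrite /series /= mulr_sumr -big_split /=.
  apply: eq_bigr => i _; rewrite -innerZl -innerDl.
  by [].
apply: cvgD; last exact: vector_functional_cvg.
by apply: cvgM; [exact: cvg_cst|exact: vector_functional_cvg].
Qed.

Lemma vector_functional_continuous p :
  continuous (@vector_functional R H M p : sigma_weak M -> R[i]^o).
Proof.
move=> u; have Fu : Filter (nbhs (u : sigma_weak M)) by exact: nbhs_filter.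
have /cvg_sup /(_ p) up : nbhs (u : sigma_weak M) --> (u : sigma_weak M) by [].
apply: (cvg_trans _ (@initial_continuous _ _ (@vector_functional R H M p) u)).
by move=> A /up.
Qed.

Lemma val_real phi x : self_adjoint x -> val phi x = (Re (val phi x))%:C%C.
Proof. by move=> /(predual_sa_hermitian phi) /RRe_real. Qed.

Lemma predual_of_vectors xi eta (K : R) :
  (forall n, series (cost xi eta) n <= K) ->
  exists phi, forall x, self_adjoint x ->
    series (fun n => ip (val x (xi n)) (eta n)) @ \oo --> Re (val phi x).
Proof.
move=> cK.
have ss1 : square_summable xi.
  apply: (@square_summable_bounded _ _ _ (2 * K)) => n.
  rewrite mulrC -ler_pdivrMr//; apply: le_trans (cK n).
  rewrite /series /= mulr_suml; apply: ler_sum => i _.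
  by rewrite /cost ler_wpM2r// lerDl sqr_ge0.
have ss2 : square_summable eta.
  apply: (@square_summable_bounded _ _ _ (2 * K)) => n.
  rewrite mulrC -ler_pdivrMr//; apply: le_trans (cK n).
  rewrite /series /= mulr_suml; apply: ler_sum => i _.
  by rewrite /cost ler_wpM2r// lerDr sqr_ge0.
pose p : @ell2 R H * @ell2 R H := (exist _ xi ss1, exist _ eta ss2).
pose q : @ell2 R H * @ell2 R H := (p.2, p.1).
(* For self-adjoint [x], exchanging the two sequences conjugates each term, so the half sum is the
   series of real parts and [f] is hermitian. *)
pose f : vn_sort M -> R[i]^o :=
  fun x => 2^-1 * (vector_functional p x + vector_functional q x).
have fP x : self_adjoint x -> exists2 l : R, f x = l%:C%C &
    series (fun n => ip (val x (xi n)) (eta n)) @ \oo --> l.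
  move=> xx; have ic := @series_ip_cvg _ _ _ _ _ x _ cK.
  exists (limn (series (fun n => ip (val x (xi n)) (eta n)))); last exact: ic.
  have fx : series (fun n => (ip (val x (xi n)) (eta n))%:C%C : R[i]^o)
      @ \oo --> (f x : R[i]^o).
    rewrite (_ : series _ = cst (2^-1 : R[i]^o) \*
      (series (fun n => inner (val x (sval p.1 n)) (sval p.2 n)) \+
       series (fun n => inner (val x (sval q.1 n)) (sval q.2 n)))); last first.
      apply/funext => n; rewrite /series /= -big_split /= mulr_sumr.
      apply: eq_bigr => i _; rewrite [X in _ + X]innerC -xx.
      rewrite (_ : _ + _ = 2 * (ip (val x (xi i)) (eta i))%:C%C).
        by rewrite mulrA mulVf ?mul1r// pnatr_eq0.
      rewrite /ip; set z := inner _ _.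
      exact: addcJ.
    apply: cvgM; first exact: cvg_cst.
    by apply: cvgD; exact: vector_functional_cvg.
  rewrite -(cvg_lim (@norm_hausdorff _ R[i]^o) fx).
  apply: (cvg_lim (@norm_hausdorff _ R[i]^o)).
  rewrite (_ : series _ = fun n =>
    (series (fun n => ip (val x (xi n)) (eta n)) n)%:C%C : R[i]^o).
    exact: cvg_real_complex.
  by apply/funext => n; rewrite /series /= rmorph_sum.
have fV : predual_sa_pred f.
  apply/asboolP; split; last first.
    by move=> x /fP[l -> _]; apply/complex_realP; exists l.
  split=> [a x y|u].
    rewrite /f !vector_functional_linear /GRing.scale /=; ring.
  have Fu : Filter (nbhs (u : sigma_weak M)) by exact: nbhs_filter.
  apply: (@cvgM R[i] _ (nbhs u) Fu (cst 2^-1)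
    (fun x => vector_functional p x + vector_functional q x)).
    exact: cvg_cst.
  by apply: (@cvgD R[i] R[i]^o _ (nbhs u) Fu); exact: vector_functional_continuous.
exists (exist _ f fV) => x /fP[l /= fl il].
by rewrite fl.
Qed.

End Representation.

Lemma ImN {R : realType} (z : R[i]) : Im (- z) = - Im z. Proof. by case: z. Qed.
Lemma Im_i {R : realType} (z : R[i]) : Im ('i * z) = Re z.
Proof. by rewrite -complexiE; case: z => x y /=; rewrite mul0r mul1r add0r. Qed.

(** * Self-adjoint and positive elements, and the norm of a hermitian functional *)

Section OrderNorm.
Context {R : realType} {H : hilbertSpace R} (M : vonNeumannAlgebra H).
Implicit Types (xi eta : nat -> H) (x : vn_sort M) (phi psi : predual_sa M).

Lemma vn_opD x u v : val x (u + v) = val x u + val x v.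
Proof.
have := bounded_op_lin (vn_bounded (set_mem (valP x))) 1 u v.
by rewrite !scale1r.
Qed.

Lemma vn_opZ (a : R[i]) x u : val x (a *: u) = a *: val x u.
Proof.
have := bounded_op_lin (vn_bounded (set_mem (valP x))) a u 0.
by rewrite !addr0 (bounded_op0 (vn_bounded (set_mem (valP x)))) addr0.
Qed.

Lemma self_adjoint_ip x u v : self_adjoint x -> ip (val x u) v = ip u (val x v).
Proof. by move=> xx; rewrite /ip xx. Qed.

Lemma predual_saD phi psi x :
  Re (val (phi + psi) x) = Re (val phi x) + Re (val psi x).
Proof. exact: ReD. Qed.
Lemma predual_saN phi x : Re (val (- phi) x) = - Re (val phi x).
Proof. exact: ReN. Qed.
Lemma predual_saB phi psi x :
  Re (val (phi - psi) x) = Re (val phi x) - Re (val psi x).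
Proof. exact: ReB. Qed.
Lemma predual_saZ (a : R) phi x : Re (val (a *: phi) x) = a * Re (val phi x).
Proof. exact: ReZ. Qed.
Lemma predual_sa0E x : Re (val (0 : predual_sa M) x) = 0.
Proof. by []. Qed.
Lemma predual_sa_sum (n : nat) (f : nat -> predual_sa M) x :
  Re (val (\sum_(0 <= i < n) f i) x) = \sum_(0 <= i < n) Re (val (f i) x).
Proof.
elim: n => [|n IH]; first by rewrite !big_nil.
by rewrite !big_nat_recr//= predual_saD IH.
Qed.

(** With the adjoint [z] of [x], these are [(x + z) / 2] and [(x - z) / (2 'i)]. *)
Lemma cartesian x : exists h k : vn_sort M,
  [/\ self_adjoint h, self_adjoint k, x = h + 'i *: k &
      vn_unit_ball x -> vn_unit_ball h /\ vn_unit_ball k].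
Proof.
have [y My xy] := vn_adjoint (set_mem (valP x)).
pose z : vn_sort M := exist (vn_pred M) y (mem_set My).
have yx u v : inner (y u) v = inner u (val x v) by rewrite innerC -xy -innerC.
have c2 : (2^-1 : R[i])^*%R = 2^-1.
  by apply/CrealP; rewrite realV// realn.
(* The adjoint of a contraction is one: [|y u| ^+ 2 = <u, x (y u)> <= |u| |y u|]. *)
have ball_adj : vn_unit_ball x -> vn_unit_ball z.
  move=> xb u; change (`|y u| <= `|u|).
  have [->|yu0] := eqVneq (y u) 0; first by rewrite normr0.
  have := inner_CauchySchwarz u (val x (y u)).
  rewrite -yx inner_norm normrX normr_id expr2 => yy.
  have {yu0} yu0 : 0 < `|y u| by rewrite normr_gt0.
  rewrite -(ler_pM2r yu0); apply: le_trans yy _.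
  by rewrite ler_wpM2l//; exact: xb.
exists (2^-1 *: (x + z)), (- (2^-1 * 'i) *: (x - z)); split.
- move=> u v; change (inner (2^-1 *: (val x u + y u)) v =
    inner u (2^-1 *: (val x v + y v))).
  by rewrite innerZl innerZr c2 innerDl innerDr xy yx addrC.
- move=> u v; change (inner (- (2^-1 * 'i) *: (val x u - y u)) v =
    inner u (- (2^-1 * 'i) *: (val x v - y v))).
  rewrite innerZl innerZr rmorphN rmorphM /= c2 conjCi innerBl innerBr xy yx.
  ring.
- rewrite scalerA mulrN mulrCA -expr2 sqrCi mulrN mulr1 opprK -scalerDr.
  rewrite addrACA subrr addr0 -mulr2n -(scaler_nat 2 x) scalerA.
  by rewrite mulVf ?scale1r ?pnatr_eq0.

move=> xb; have zb := ball_adj xb.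
have half (w w' : H) u : `|w| <= `|u| -> `|w'| <= `|u| ->
    2^-1 * `|w + w'| <= `|u| :> R[i].
  move=> wu w'u; rewrite -(ler_pM2l (_ : 0 < 2)) ?ltr0n//.
  rewrite mulrA divff ?pnatr_eq0// mul1r; apply: le_trans (ler_normD _ _) _.
  by rewrite mulr_natl mulr2n lerD.
split=> u.
  change (`|2^-1 *: (val x u + y u)| <= `|u|).
  rewrite normrZ ger0_norm ?invr_ge0//; apply: half; [exact: xb|exact: zb].
change (`|- (2^-1 * 'i) *: (val x u - y u)| <= `|u|).
rewrite normrZ normrN normrM normCi mulr1 ger0_norm ?invr_ge0//.
by apply: half; [exact: xb|rewrite normrN; exact: zb].
Qed.

Lemma predual_sa_cartesian phi h k :
  val phi (h + 'i *: k) = val phi h + 'i * val phi k.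
Proof. by rewrite addrC predual_sa_linear addrC. Qed.

Lemma predual_sa_ext phi psi :
  (forall x, self_adjoint x -> Re (val phi x) = Re (val psi x)) -> phi = psi.
Proof.
move=> pp; apply: val_inj; apply/funext => x.
have [h [k [hh kk -> _]]] := cartesian x.
rewrite !predual_sa_cartesian (val_real phi hh) (val_real phi kk).
by rewrite (val_real psi hh) (val_real psi kk) !pp.
Qed.

(** The factor 2 is the price of splitting an element of the unit ball into two self-adjoint
    ones. *)
Lemma predual_sa_norm_le2 phi (c : R) :
  (forall x, self_adjoint x -> vn_unit_ball x -> `|Re (val phi x)| <= c) ->
  `|phi| <= 2 * c.
Proof.
move=> pc; apply: predual_sa_norm_le => x xb.
have [h [k [hh kk xE /(_ xb)[hb kb]]]] := cartesian x; rewrite xE.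
rewrite predual_sa_cartesian; apply: le_trans (le_normcD _ _) _.
rewrite ComplexField.Normc.normcM (val_real phi hh) (val_real phi kk) /=.
rewrite !(expr0n, expr1n) /= !addr0 add0r sqrtr1 mul1r !sqrtr_sqr.
by have := pc _ hh hb; have := pc _ kk kb; lra.
Qed.

Lemma Re_le_norm phi x : vn_unit_ball x -> `|Re (val phi x)| <= `|phi|.
Proof.
move=> xb; apply: le_trans (normr_Re _) _; exact: predual_sa_norm_ub.
Qed.

Lemma Re_le_bound phi x (c : R) : 0 < c ->
  (forall u, nrm (val x u) <= c * nrm u) ->
  `|Re (val phi x)| <= c * `|phi|.
Proof.
move=> c0 xc; pose y := ((c^-1)%:C%C : R[i]) *: x.
have yb : vn_unit_ball y.
  move=> u; change (`|(c^-1)%:C%C *: val x u| <= `|u|).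
  by rewrite !nrmE lecR nrmZ gtr0_norm ?invr_gt0// ler_pdivrMl.
have -> : x = c%:C%C *: y + 0.
  rewrite addr0 scalerA -rmorphM /= divff ?scale1r//; exact: lt0r_neq0.
rewrite predual_sa_linear predual_sa0 addr0 /GRing.scale /= ReZ normrM.
by rewrite gtr0_norm// ler_pM2l//; exact: Re_le_norm.
Qed.

Lemma adjoint_of_ip (x y : H -> H) : (forall v, y ('i *: v) = 'i *: y v) ->
  (forall u v, ip (x u) v = ip u (y v)) -> is_adjoint x y.
Proof.
move=> yi xy u v; have IE (a b : R[i]) : Re a = Re b -> Im a = Im b -> a = b.
  by case: a; case: b => ? ? ? ? /= -> ->.
by apply: IE; [exact: xy|rewrite !Im_inner xy yi].
Qed.

(** Polarization: as the quadratic form is real at [u + v], the imaginary parts of [<x u, v>] and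
    [<x v, u>] cancel; replacing [u] by ['i *: u] compares the real parts. *)
Lemma positive_self_adjoint x : positive_op (val x) -> self_adjoint x.
Proof.
move=> x0; have ImR u : Im (inner (val x u) u) = 0.
  by have := x0 u; rewrite lecE => /andP[/eqP -> _].
have ImD u v : Im (inner (val x u) v) + Im (inner (val x v) u) = 0.
  have := ImR (u + v); rewrite vn_opD innerDl !innerDr.
  have ID (a b : R[i]) : Im (a + b) = Im a + Im b by case: a; case: b.
  by rewrite !ID !ImR; lra.
have ipS u v : ip (val x u) v = ip u (val x v).
  have := ImD ('i *: u) v; rewrite vn_opZ innerZl innerZr conjCi.
  by rewrite mulNr ImN !Im_i /ip [inner u _]innerC Re_conj; lra.
by apply: adjoint_of_ip ipS => v; exact: vn_opZ.
Qed.

End OrderNorm.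

(** * Representation of normal functionals by vectors *)

(** Induction on [n]. If some [x0] in the kernel of the first [n] functionals has [F n x0 != 0], a
    multiple of [F n] is subtracted from [f]; otherwise [F n] vanishes on that kernel and gets
    coefficient 0. *)
Lemma linear_combination_of_kernel (K : fieldType) (V : lmodType K) (n : nat)
  (F : nat -> V -> K^o) (f : V -> K^o) :
  (forall i, linear (F i)) -> linear f ->
  (forall x, (forall i, (i < n)%N -> F i x = 0) -> f x = 0) ->
  exists c : nat -> K, forall x, f x = \sum_(i < n) c i * F i x.
Proof.
move=> Fl; elim: n f => [|n IH] f fl fF.
  by exists (fun=> 0) => x; rewrite big_ord0 fF.
have [[x0 [x00 Fx0]]|nx0] :=
    pselect (exists x0, (forall i, (i < n)%N -> F i x0 = 0) /\ F n x0 != 0).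
  pose a := f x0 / F n x0.
  have [||c cP] := IH (fun x => f x - a * F n x).
  - move=> b u v; rewrite fl Fl /GRing.scale /=; ring.
  - move=> x xF; apply/eqP; rewrite subr_eq0; apply/eqP.
    pose b := F n x / F n x0.
    have : f (- b *: x0 + x) = 0.
      apply: fF => i; rewrite ltnS leq_eqVlt => /predU1P[->|ilt].
        by rewrite Fl /GRing.scale /= /b mulNr divfK// addNr.
      by rewrite Fl x00// xF// scaler0 addr0.
    rewrite fl /GRing.scale /= mulNr => /eqP; rewrite addrC subr_eq0 => /eqP ->.
    by rewrite /a /b; field.
  exists (fun i => if i == n then a else c i) => x.
  rewrite big_ord_recr /= eqxx -[LHS](subrK (a * F n x)) cP; congr (_ + _).
  by apply: eq_bigr => i _; rewrite ltn_eqF.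
have [//||c cP] := IH f.
  move=> x xF; apply: fF => i; rewrite ltnS leq_eqVlt => /predU1P[->|]; last first.
    exact: xF.
  by apply/eqP; apply: contrapT => /negP Fx; apply: nx0; exists x.
exists (fun i => if i == n then 0 else c i) => x.
rewrite big_ord_recr /= eqxx mul0r addr0 cP.
by apply: eq_bigr => i _; rewrite ltn_eqF.
Qed.

Lemma cvg_series_fin {R : realType} (u : nat -> R) (n : nat) :
  (forall i, (n <= i)%N -> u i = 0) -> series u @ \oo --> series u n.
Proof.
move=> u0; apply: cvg_near_cst; exists n => // m /= nm.
rewrite /series /= (big_cat_nat (leq0n n) nm) /= [X in _ + X]big_nat_cond.
rewrite [X in _ + X]big1 ?addr0//.
by move=> i /andP[/andP[ni _] _]; exact: u0.
Qed.

Section Representation.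
Context {R : realType} {H : hilbertSpace R} (M : vonNeumannAlgebra H).
Implicit Types (xi eta : nat -> H) (x : vn_sort M) (phi psi : predual_sa M).

(** Real parts on self-adjoint elements determine [phi] by [predual_sa_ext], so the real form [ip]
    suffices. *)
Definition represented phi (K : R) := exists xi eta,
  (forall n, series (cost xi eta) n <= K) /\
  forall x, self_adjoint x ->
    series (fun n => ip (val x (xi n)) (eta n)) @ \oo --> Re (val phi x).

Lemma represented_ge0 phi K : represented phi K -> 0 <= K.
Proof. by move=> [xi [eta [/(_ 0%N) + _]]]; rewrite /series /= big_nil. Qed.

Lemma represented0 : represented 0 0.
Proof.
exists (fun=> 0), (fun=> 0); split=> [n|x _].
  by rewrite /series /= big1// => i _; rewrite /cost nrm0; lra.
rewrite (_ : series _ = cst 0); first exact: cvg_cst.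
apply/funext => n; rewrite /series /= big1// => i _.
by have := ipZr 0 (val x 0) 0; rewrite scaler0 mul0r.
Qed.

(** A bijection between [nat] and [nat * nat] concatenates the representations into one; the costs
    add up and dominate the terms, which justifies the rearrangement. *)
Lemma represented_series (f : nat -> predual_sa M) (K : nat -> R) (L : R) :
  (forall k, represented (f k) (K k)) -> (forall n, series K n <= L) ->
  exists2 phi, represented phi L &
    forall x, self_adjoint x ->
      series (fun k => Re (val (f k) x)) @ \oo --> Re (val phi x).
Proof.
move=> fK KL.
have /choice[xi /choice[eta xieta]] := fK.
have /card_esym /card_set_bijP[e eb] := card_nat2.
pose xi' n := xi (e n).1 (e n).2; pose eta' n := eta (e n).1 (e n).2.
pose c p := cost (xi p.1) (eta p.1) p.2.
have cL n : series (cost xi' eta') n <= L.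
  apply: (@double_series_bound _ e c K L) => // [p|k m].
    exact: cost_ge0.
  exact: (xieta k).1.
have [phi phiP] := predual_of_vectors M cL.
exists phi; first by exists xi', eta'.
move=> x xx; have [b b0 xb] := vn_op_bound x.
pose r p := ip (val x (xi p.1 p.2)) (eta p.1 p.2).
apply: (@double_series_cvg _ e r c K _ b L) => //.
- by move=> p; exact: ip_cost.
- by move=> p; exact: cost_ge0.
- by move=> k; exact: (xieta k).1.
- by move=> k; exact: (xieta k).2.
exact: phiP.
Qed.

Lemma representedD phi psi K L : represented phi K -> represented psi L ->
  represented (phi + psi) (K + L).
Proof.
move=> rphi rpsi.
(* The sum is a series whose terms from index 2 on are the [nth] default 0, represented at cost
   0. *)
pose f k := nth 0 [:: phi; psi] k; pose C k := nth 0 [:: K; L] k.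
have s2 (g : nat -> R) n : (forall i, (2 <= i)%N -> g i = 0) ->
    (forall i, 0 <= g i) -> series g n <= g 0%N + g 1%N.
  move=> g0 gge; case: n => [|[|n]]; rewrite /series /=.
  - by rewrite big_nil addr_ge0.
  - by rewrite big_nat1 lerDl.
  by rewrite !big_nat_recl// big1 ?addr0// => i _; exact: g0.
have C2 i : (2 <= i)%N -> C i = 0 by move=> ?; rewrite /C nth_default.
have C0 i : 0 <= C i.
  case: i => [|[|i]]; [exact: represented_ge0 rphi|exact: represented_ge0 rpsi|].
  by rewrite C2.
have fC k : represented (f k) (C k).
  by case: k => [|[|k]] //; rewrite /f C2// nth_default//; exact: represented0.
have [chi rchi chiP] := represented_series fC (fun n => s2 C n C2 C0).
suff <- : chi = phi + psi by [].
apply: predual_sa_ext => x xx; rewrite predual_saD.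
have := @cvg_series_fin _ (fun k => Re (val (f k) x)) 2.
rewrite /series /= !big_nat_recl// big_nil addr0 => sc.
rewrite -(cvg_lim (@norm_hausdorff _ R^o) (chiP x xx)).
apply: (cvg_lim (@norm_hausdorff _ R^o)); apply: sc => -[|[|i]]// _.
by rewrite /f nth_default.
Qed.

Lemma representedN phi K : represented phi K -> represented (- phi) K.
Proof.
move=> [xi [eta [cK xK]]]; exists xi, (fun n => - eta n); split=> [n|x xx].
  by apply: le_trans (cK n); apply: ler_sum => i _; rewrite /cost nrmN.
rewrite predual_saN (_ : series _ = - series (fun n => ip (val x (xi n)) (eta n))).
  by apply: cvgN; exact: xK.
by apply/funext => n; rewrite fctE /series /= -sumrN; apply: eq_bigr => i _;
  rewrite ipNr.
Qed.

Lemma representedZ t phi K : 0 <= t -> represented phi K ->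
  represented (t *: phi) (t * K).
Proof.
(* Sharing the scalar evenly between the two sequences multiplies the cost by exactly [t]. *)
move=> t0 [xi [eta [cK xK]]]; pose s := Num.sqrt t.
have ss : s * s = t by rewrite -expr2 sqr_sqrtr.
exists (fun n => s%:C%C *: xi n), (fun n => s%:C%C *: eta n).
split=> [n|x xx].
  have -> : series (cost (fun n => s%:C%C *: xi n) (fun n => s%:C%C *: eta n)) n =
      t * series (cost xi eta) n.
    rewrite /series /= mulr_sumr; apply: eq_bigr => i _.
    rewrite /cost !nrmZ ger0_norm ?sqrtr_ge0// -ss; ring.
  by rewrite ler_wpM2l.
rewrite predual_saZ (_ : series _ =
    cst t \* series (fun n => ip (val x (xi n)) (eta n))).
  by apply: cvgM; [exact: cvg_cst|exact: xK].
apply/funext => n; rewrite /series /= mulr_sumr; apply: eq_bigr => i _.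
by rewrite ipZr self_adjoint_ip// ipZl -self_adjoint_ip// mulrA ss.
Qed.

(* The sets containing the common kernel of finitely many vector functionals
   form a filter, which converges to 0 for the sigma-weak topology. *)
Lemma finite_support phi : exists (n : nat) (p : nat -> @ell2 R H * @ell2 R H),
  forall x, (forall i, (i < n)%N -> vector_functional (p i) x = 0) ->
    val phi x = 0.
Proof.
pose ker n (p : nat -> @ell2 R H * @ell2 R H) : set (vn_sort M) :=
  [set x | forall i, (i < n)%N -> vector_functional (p i) x = 0].
pose F : set_system (vn_sort M) := [set A | exists n p, ker n p `<=` A].
have s0 : @square_summable R H (fun=> 0).
  apply: (@square_summable_bounded _ _ _ 0) => n.
  by rewrite /series /= big1// => i _; rewrite nrm0 expr0n.
have FF : Filter F.
  split.
  - by exists 0%N, (fun=> (exist _ _ s0, exist _ _ s0)).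
  - move=> A B [n [p pA]] [m [q qB]].
    exists (n + m)%N, (fun i => if (i < n)%N then p i else q (i - n)%N) => x xk.
    split; [apply: pA => i ilt|apply: qB => i ilt].
      by have := xk i; rewrite ilt; apply; rewrite ltn_addr.
    have := xk (n + i)%N; rewrite ltn_add2l => /(_ ilt).
    by rewrite ltnNge leq_addr addKn.
  by move=> A B AB [n [p pA]]; exists n, p => x /pA /AB.
have F0 : F --> (0 : sigma_weak M).
  apply/cvg_sup => p A; rewrite nbhsE => -[B [[C Co <-] C0] CA].
  exists 1%N, (fun=> p) => x /(_ 0%N isT) px; apply: CA.
  rewrite /preimage /= px.
  have := vector_functional_linear p (-1) (0 : vn_sort M) 0.
  rewrite scaler0 scaleN1r addNr addr0 => v0.
  by move: C0; rewrite /preimage /= v0.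
have : nbhs (0 : sigma_weak M) [set x | `|val phi x| < 1].
  have phic := predual_sa_continuous phi 0.
  have /cvgrPdist_lt/(_ 1 ltr01) := phic.
  by rewrite predual_sa0; apply: filterS => x /=; rewrite sub0r normrN.
move=> /F0 [n [p pk]]; exists n, p => x xk.
apply/eqP; rewrite -normr_eq0; apply: contrapT => /negP p0.
(* The kernel is closed under scaling, so a nonzero value of [phi] on it could be scaled to 1,
   against [|phi| < 1] there. *)
have p1 : ker n p ((val phi x)^-1 *: x).
  move=> i ilt; have := vector_functional_linear (p i) (val phi x)^-1 x 0.
  have := vector_functional_linear (p i) (-1) (0 : vn_sort M) 0.
  rewrite scaler0 scaleN1r addNr addr0 => ->.
  by rewrite !addr0 xk// scaler0.
have /= := pk _ p1; have := predual_sa_linear phi (val phi x)^-1 x 0.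
rewrite addr0 predual_sa0 addr0 => ->.
rewrite /GRing.scale /= mulVf ?normr1 ?ltxx//.
by rewrite -normr_eq0.
Qed.

(** Sigma-weak continuity makes [phi] a finite combination of vector functionals. Each summand need
    not be hermitian, so it is replaced by the hermitian functional with the same real part on
    self-adjoint elements. *)
Lemma represented_exists phi : exists K, represented phi K.
Proof.
have [n [p pP]] := finite_support phi.
have [|c cP] := @linear_combination_of_kernel _ _ n
  (fun i => vector_functional (p i)) (val phi) _ (predual_sa_linear phi) pP.
  by move=> i; exact: vector_functional_linear.
have /choice[f fP] : forall i : nat, exists psi,
    (exists K, represented psi K) /\
    forall x, self_adjoint x ->
      Re (val psi x) = Re (c i * vector_functional (p i) x).
  move=> i; have [K KP] := ell2_cost_bound (p i).
  pose xi n := c i *: sval (p i).1 n; pose eta := sval (p i).2.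
  have [k kE] : exists k, `|c i| = k%:C%C.
    by exists (Re `|c i|); rewrite RRe_real ?normr_real.
  have nc m : nrm (xi m) = k * nrm (sval (p i).1 m).
    by rewrite /nrm normrZ kE ReZ.
  (* The scalar goes into the first sequence only; [1 + k ^+ 2] bounds both resulting factors
     [k ^+ 2] and 1. *)
  have cK m : series (cost xi eta) m <= (1 + k ^+ 2) * K.
    apply: le_trans (ler_wpM2l _ (KP m)); last by rewrite addr_ge0 ?sqr_ge0.
    rewrite /series /= mulr_sumr; apply: ler_sum => j _.
    rewrite /cost nc exprMn -/eta.
    have := sqr_ge0 (nrm (eta j)); have := sqr_ge0 (nrm (sval (p i).1 j)).
    have := sqr_ge0 k; move: (k ^+ 2) (nrm _ ^+ 2) (nrm _ ^+ 2) => a b d; nra.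
  have [psi psiP] := predual_of_vectors M cK.
  exists psi; split; first by exists ((1 + k ^+ 2) * K), xi, eta.
  move=> x xx; rewrite -(cvg_lim (@norm_hausdorff _ R^o) (psiP x xx)).
  apply: (cvg_lim (@norm_hausdorff _ R^o)).
  pose v := cst (c i : R[i]^o) \*
    series (fun n => inner (val x (sval (p i).1 n)) (sval (p i).2 n)).
  have vc : v @ \oo --> (c i * vector_functional (p i) x : R[i]^o).
    by apply: cvgM; [exact: cvg_cst|exact: vector_functional_cvg].
  rewrite (_ : series _ = fun m => Re (v m)); first exact: cvg_Re.
  apply/funext => m.
  rewrite /v /series /= mulr_sumr Re_sum; apply: eq_bigr => j _.
  by rewrite /ip /xi vn_opZ innerZl.
have -> : phi = \sum_(0 <= i < n) f i.
  apply: predual_sa_ext => x xx; rewrite predual_sa_sum cP Re_sum big_mkord.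
  by apply: eq_bigr => i _; rewrite (fP i).2.
elim: n {p pP c cP fP} (fun i => (fP i).1) => [|n IH] fr.
  by rewrite big_nil; exists 0; exact: represented0.
have [K1 K1P] := IH fr; have [K2 K2P] := fr n.
by rewrite big_nat_recr//=; exists (K1 + K2); exact: representedD.
Qed.

End Representation.

(** * The projective norm and its duality with the algebra *)

Section ProjectiveNorm.
Context {R : realType} {H : hilbertSpace R} (M : vonNeumannAlgebra H).
Implicit Types (xi eta : nat -> H) (x : vn_sort M) (phi psi : predual_sa M).

Definition projective_norm phi : R := inf [set K | represented phi K].

Lemma projective_norm_le phi K : represented phi K -> projective_norm phi <= K.
Proof. by move=> rK; apply: ge_inf => //; exists 0 => L /represented_ge0. Qed.

Lemma projective_norm_lt phi (K : R) : projective_norm phi < K ->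
  exists2 L, L < K & represented phi L.
Proof.
move=> pK; have hi : has_inf [set K | represented phi K].
  split; first by have [L] := represented_exists phi; exists L.
  by exists 0 => L /represented_ge0.
have e0 : 0 < K - projective_norm phi by rewrite subr_gt0.
have [L rL] := inf_adherent e0 hi.
by rewrite -/(projective_norm phi) addrC subrK => LK; exists L.
Qed.

Lemma projective_norm_sublinear : sublinear projective_norm.
Proof.
split=> [phi psi|t phi t0].
  apply/ler_addgt0Pr => e e0; have e20 : 0 < e / 2 by rewrite divr_gt0.
  have [K Kl rK] := @projective_norm_lt phi (projective_norm phi + e / 2)
    (ltr_pwDr e20 (lexx _)).
  have [L Ll rL] := @projective_norm_lt psi (projective_norm psi + e / 2)
    (ltr_pwDr e20 (lexx _)).
  by apply: le_trans (projective_norm_le (representedD rK rL)) _; lra.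
move: t0; rewrite le_eqVlt => /predU1P[<-|t0].
  by rewrite scale0r mul0r; apply: projective_norm_le; exact: represented0.
rewrite -ler_pdivrMl//; apply/ler_addgt0Pr => e e0.
have [K Kl rK] := @projective_norm_lt phi (projective_norm phi + e)
  (ltr_pwDr e0 (lexx _)).
rewrite ler_pdivrMl//.
apply: le_trans (projective_norm_le (representedZ (ltW t0) rK)) _.
by rewrite ler_pM2l// ltW.
Qed.

Lemma rank_one (u v : H) :
  exists2 phi, represented phi ((nrm u ^+ 2 + nrm v ^+ 2) / 2) &
  forall x, self_adjoint x -> Re (val phi x) = ip (val x u) v.
Proof.
pose xi (n : nat) : H := if n is 0%N then u else 0.
pose eta (n : nat) : H := if n is 0%N then v else 0.
have cK n : series (cost xi eta) n <= (nrm u ^+ 2 + nrm v ^+ 2) / 2.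
  case: n => [|n]; rewrite /series /=.
    by rewrite big_nil; exact: (cost_ge0 xi eta 0).
  rewrite big_nat_recl// big1 ?addr0// => i _.
  by rewrite /cost /= nrm0; lra.
have [phi phiP] := predual_of_vectors M cK.
exists phi; first by exists xi, eta.
move=> x xx; have := phiP x xx.
have := @cvg_series_fin _ (fun n => ip (val x (xi n)) (eta n)) 1.
rewrite /series /= big_nat1 => sc /(cvg_lim (@norm_hausdorff _ R^o)) <-.
apply: (cvg_lim (@norm_hausdorff _ R^o)); apply: sc => -[|i]//= _.
by have := ipZr 0 (val x 0) 0; rewrite scaler0 mul0r.
Qed.

Lemma projective_dual (F : predual_sa M -> R) :
  (forall phi psi, F (phi + psi) = F phi + F psi) ->
  (forall t phi, F (t *: phi) = t * F phi) ->
  (forall phi, F phi <= projective_norm phi) ->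
  exists2 x, vn_unit_ball x & forall phi, F phi = Re (val phi x).
Proof.
move=> FD FZ Fp.
have FN phi : F (- phi) = - F phi by rewrite -scaleN1r FZ mulN1r.
have FK phi K : represented phi K -> `|F phi| <= K.
  move=> rK; rewrite ler_norml lerNl -FN.
  rewrite (le_trans (Fp _) (projective_norm_le rK)).
  by rewrite (le_trans (Fp _) (projective_norm_le (representedN rK))).
have /choice[r rP] : forall p : H * H, exists phi,
    represented phi ((nrm p.1 ^+ 2 + nrm p.2 ^+ 2) / 2) /\
    forall x, self_adjoint x -> Re (val phi x) = ip (val x p.1) p.2.
  by move=> p; have [phi] := rank_one p.1 p.2; exists phi.
pose rho u v := r (u, v).
have rhoE u v x : self_adjoint x -> Re (val (rho u v) x) = ip (val x u) v.
  by move=> xx; exact: (rP (u, v)).2.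
pose G u v := F (rho u v).
have GC u v : G u v = G v u.
  congr F; apply: predual_sa_ext => x xx.
  by rewrite !rhoE// ipC -self_adjoint_ip.
have GDl u v w : G (u + v) w = G u w + G v w.
  rewrite /G -FD; congr F; apply: predual_sa_ext => x xx.
  by rewrite predual_saD !rhoE// vn_opD ipDl.
have GZl t u v : G (t%:C%C *: u) v = t * G u v.
  rewrite /G -FZ; congr F; apply: predual_sa_ext => x xx.
  by rewrite predual_saZ !rhoE// vn_opZ ipZl.
have Gi u v : G ('i *: u) v = G u (- ('i *: v)).
  congr F; apply: predual_sa_ext => x xx.
  by rewrite !rhoE// vn_opZ ip_i.
have Gle2 u v : `|G u v| <= (nrm u ^+ 2 + nrm v ^+ 2) / 2.
  exact/FK/(rP (u, v)).1.
have nrm0_eq (u : H) : nrm u = 0 -> u = 0.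
  by move=> u0; apply/eqP; rewrite -normr_eq0 nrmE u0.
(* Scaling [u] by [nrm v] and [v] by [nrm u] gives both the norm [nrm u * nrm v], where the mean of
   squares in [Gle2] is no larger than the product. *)
have Gle u v : `|G u v| <= 1 * nrm u * nrm v.
  rewrite mul1r; have [/nrm0_eq ->|u0] := eqVneq (nrm u) 0.
    have := GZl 0 0 v; rewrite scaler0 mul0r => ->.
    by rewrite normr0 mulr_ge0 ?nrm_ge0.
  have [/nrm0_eq ->|v0] := eqVneq (nrm v) 0.
    have := GZl 0 0 u; rewrite scaler0 mul0r GC => ->.
    by rewrite normr0 mulr_ge0 ?nrm_ge0.
  have uv0 : 0 < nrm u * nrm v by rewrite mulr_gt0// lt_def nrm_ge0 ?u0 ?v0.
  rewrite -(ler_pM2l uv0).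
  have := Gle2 ((nrm v)%:C%C *: u) ((nrm u)%:C%C *: v).
  rewrite GZl [G u _]GC GZl [G v u]GC !nrmZ !normrM !(ger0_norm (nrm_ge0 _)).
  by move: (nrm u) (nrm v) `|_| => a b c; lra.
have [|u t v|a [ba aG]] := op_of_form GDl _ GZl _ Gi Gle.
- by move=> u v w; rewrite GC GDl !(GC u).
- by rewrite GC GZl GC.
(* For [t] in the commutant with adjoint [t'], the rank one functionals of [(u, t' w)] and
   [(t u, w)] agree on the algebra's self-adjoint elements. Hence [G] agrees on both pairs, and [a]
   commutes with [t]. *)
have Ma : vn_set M a.
  rewrite -(vn_bicommutant M); split=> // t [bt tM].
  have [t' tt'] := adjoint_exists bt.
  apply/funext => u; apply: ip_ext => w /=.
  rewrite tt' -!aG; congr F; apply: predual_sa_ext => x xx.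
  rewrite !rhoE// -tt'; congr (ip _ w).
  by have /(congr1 (@^~ u)) := tM _ (set_mem (valP x)).
pose A : vn_sort M := exist (vn_pred M) a (mem_set Ma).
have AA : self_adjoint A.
  apply: adjoint_of_ip => [v|u v]; first exact: vn_opZ.
  by rewrite -aG GC aG ipC.
exists A.
  move=> u; change (`|a u| <= `|u|); rewrite !nrmE lecR.
  have [->|a0] := eqVneq (nrm (a u)) 0; first exact: nrm_ge0.
  have {}a0 : 0 < nrm (a u) by rewrite lt_def a0 nrm_ge0.
  rewrite -(ler_pM2r a0) -expr2 -ip_nrm -aG.
  by apply: le_trans (ler_norm _) _; have := Gle u (a u); rewrite mul1r.
move=> phi; have [K [xi [eta [cK phiP]]]] := represented_exists phi.
have cc := bounded_series_cvg (cost_ge0 xi eta) cK.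
pose C := limn (series (cost xi eta)).
pose S n := \sum_(0 <= i < n) rho (xi i) (eta i).
have FS n : F (S n) = series (fun i => ip (a (xi i)) (eta i)) n.
  rewrite /S /series /=; elim: n => [|n IH]; last first.
    by rewrite !big_nat_recr//= FD IH -aG.
  by rewrite !big_nil -(scale0r 0) FZ mul0r.
(* The tail of the representation represents the remainder, at a cost that tends to 0; by [FK] this
   gives [F (S n) --> F phi]. *)
have rS n : represented (phi - S n) (C - series (cost xi eta) n).
  exists (fun i => xi (n + i)%N), (fun i => eta (n + i)%N).
  have split_sum (f : nat -> R) m :
      series (fun i => f (n + i)%N) m = series f (n + m)%N - series f n.
    rewrite /series /= (big_cat_nat (leq0n n) (leq_addr m n)) /= addrAC subrr add0r.
    rewrite -[X in _ = \sum_(X <= _ < _) _]add0n big_addn addKn.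
    by apply: eq_bigr => i _; rewrite addnC.
  split=> [m|x xx].
    rewrite (split_sum (cost xi eta)) lerD2r.
    apply: nondecreasing_cvgn_le => //.
    apply/nondecreasing_seqP => k.
    by rewrite /series /= big_nat_recr//= lerDl cost_ge0.
  rewrite predual_saB predual_sa_sum.
  have -> : \sum_(0 <= i < n) Re (val (rho (xi i) (eta i)) x) =
      series (fun i => ip (val x (xi i)) (eta i)) n.
    by rewrite /series /=; apply: eq_bigr => i _; rewrite rhoE.
  pose f i := ip (val x (xi i)) (eta i).
  rewrite (_ : series _ = fun m => series f (n + m)%N - series f n); last first.
    by apply/funext => m; rewrite -(split_sum f).
  apply: cvgB; last exact: cvg_cst.
  rewrite (_ : (fun m => _) = [sequence (series f) (m + n)%N]_m); last first.
    by apply/funext => m; rewrite addnC.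
  by rewrite (cvg_shiftn n (series f)); exact: phiP.
have lim1 : (fun n => F (S n)) @ \oo --> F phi.
  apply: (@cvg_dist_le _ _ (fun n => C - series (cost xi eta) n)).
    by move=> n; rewrite distrC -FN -FD; exact: FK.
  by rewrite -(subrr C); apply: cvgB; [exact: cvg_cst|exact: cc].
rewrite -(cvg_lim (@norm_hausdorff _ R^o) lim1).
apply: (cvg_lim (@norm_hausdorff _ R^o)).
by rewrite (funext FS); exact: (phiP A).
Qed.

Theorem projective_norm_le_norm phi : projective_norm phi <= `|phi|.
Proof.
have [F [FD FZ Fp <-]] := hahn_banach phi projective_norm_sublinear.
have [x xb ->] := projective_dual FD FZ Fp.
exact: le_trans (ler_norm _) (Re_le_norm _ xb).
Qed.

Corollary norm_lt_represented phi (K : R) : `|phi| < K -> represented phi K.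
Proof.
move=> pK; have [L LK [xi [eta [cL xL]]]] :=
  projective_norm_lt (le_lt_trans (projective_norm_le_norm phi) pK).
exists xi, eta; split=> // n; exact: le_trans (cL n) (ltW LK).
Qed.

End ProjectiveNorm.

(** * Geometric rates *)

Section HalfPowers.
Context {R : realType}.

Definition half_pow (n : nat) : R := 2^-1 ^+ n.

Lemma half_pow_gt0 n : 0 < half_pow n.
Proof. by rewrite exprn_gt0// invr_gt0. Qed.

Lemma half_powS n : half_pow n = 2 * half_pow n.+1.
Proof. by rewrite /half_pow exprS; field. Qed.

Lemma half_pow_lt (e : R) : 0 < e ->
  exists N, forall n, (N <= n)%N -> half_pow n < e.
Proof.
move=> e0; have h0 : half_pow @ \oo --> (0 : R).
  by apply: cvg_expr; rewrite ger0_norm ?invr_ge0// invf_lt1// ltr1n.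
have [N _ NP] := cvgr0_norm_lt _ h0 _ e0.
exists N => n Nn; exact: le_lt_trans (ler_norm _) (NP n Nn).
Qed.

Lemma series_half_pow n : series half_pow n = 2 - 2 * half_pow n.
Proof.
elim: n => [|n IH]; first by rewrite /series /= big_nil /half_pow expr0; lra.
rewrite /series /= big_nat_recr//=; move: IH; rewrite /series /= => ->.
by rewrite [in LHS]half_powS; lra.
Qed.

End HalfPowers.

(** * Order and norm on the hermitian predual *)

Section PredualOrder.
Context {R : realType} {H : hilbertSpace R} (M : vonNeumannAlgebra H).
Local Notation V := (predual_sa M).
Implicit Types (xi eta : nat -> H) (x : vn_sort M) (phi psi : V).

Lemma predual_leP phi psi : reflect
  (forall x, positive_op (val x) -> Re (val phi x) <= Re (val psi x))
  (phi <= psi)%O.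
Proof.
apply: (iffP (asboolP _)) => pp x x0.
  by have := pp x x0; rewrite lecE => /andP[].
have xx := positive_self_adjoint x0.
by rewrite (val_real phi xx) (val_real psi xx) lecR; exact: pp.
Qed.

Lemma predual_subr_ge0 phi psi : (0 <= psi - phi)%O = (phi <= psi)%O.
Proof.
by apply/predual_leP/predual_leP => pp x /pp;
  rewrite predual_saB predual_sa0E subr_ge0.
Qed.

Lemma predual_leN2 phi psi : (- psi <= - phi)%O = (phi <= psi)%O.
Proof.
by rewrite -[LHS]predual_subr_ge0 -[RHS]predual_subr_ge0 opprK addrC.
Qed.

Lemma predual_leD2l chi phi psi : (chi + phi <= chi + psi)%O = (phi <= psi)%O.
Proof.
by rewrite -[LHS]predual_subr_ge0 opprD addrACA subrr add0r predual_subr_ge0.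
Qed.

Definition vn_one : vn_sort M := exist (vn_pred M) id (mem_set (vn_id M)).

Lemma positive_one : positive_op (val vn_one).
Proof. by move=> u; rewrite inner_norm exprn_ge0. Qed.

Lemma ball_one : vn_unit_ball vn_one.
Proof. by []. Qed.

(** For a self-adjoint contraction [x], both [1 + x] and [1 - x] are positive, so the value at [x]
    is at most the value at 1 in modulus. *)
Lemma positive_norm_le phi : (0 <= phi)%O -> `|phi| <= 2 * Re (val phi vn_one).
Proof.
move=> /predual_leP p0; apply: predual_sa_norm_le2 => x xx xb.
have pos y : self_adjoint y -> vn_unit_ball y ->
    0 <= Re (val phi vn_one) + Re (val phi y).
  move=> yy yb; have yb1 u : `|val y u| <= 1 * `|u| by rewrite mul1r; exact: yb.
  have := p0 _ (sa_add_positive yy yb1 : positive_op (val (1 *: vn_one + y))).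
  have -> : val phi (1 *: vn_one + y) = val phi vn_one + val phi y.
    by rewrite predual_sa_linear scale1r.
  by rewrite ReD.
have Nx : self_adjoint (- x).
  move=> u v; change (inner (- val x u) v = inner u (- val x v)).
  by rewrite -[- val x u]scaleN1r -[- val x v]scaleN1r innerZl innerZr rmorphN1 xx.
have Nb : vn_unit_ball (- x).
  by move=> u; change (`|- val x u| <= `|u|); rewrite normrN; exact: xb.
have phiN : Re (val phi (- x)) = - Re (val phi x).
  have := predual_sa_linear phi (-1) x 0.
  by rewrite addr0 predual_sa0 addr0 !scaleN1r => ->; rewrite ReN.
by have := pos _ xx xb; have := pos _ Nx Nb; rewrite phiN ler_norml; lra.
Qed.

Lemma between_norm_le phi psi : (0 <= phi)%O -> (phi <= psi)%O ->
  `|phi| <= 2 * `|psi|.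
Proof.
move=> p0 /predual_leP pp; apply: le_trans (positive_norm_le p0) _.
rewrite ler_pM2l//; apply: le_trans (pp _ positive_one) _.
exact: le_trans (ler_norm _) (Re_le_norm _ ball_one).
Qed.

(** Evaluation at a fixed operator is norm continuous, so the order survives norm limits.
    Inequalities on the other side are reached by negation. *)
Lemma predual_le_closed phi psi :
  (forall e : R, 0 < e -> exists2 chi, (phi <= chi)%O & `|psi - chi| < e) ->
  (phi <= psi)%O.
Proof.
move=> pp; apply/predual_leP => x x0; apply/ler_addgt0Pr => e e0.
have [c c0 xc] := vn_op_bound x.
have c1 : 0 < c + 1 by rewrite ltr_wpDl.
have xc1 u : nrm (val x u) <= (c + 1) * nrm u.
  by apply: le_trans (xc u) _; rewrite ler_wpM2r ?nrm_ge0// lerDl.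
have [|chi /predual_leP/(_ x x0) pc] := pp (e / (c + 1)); first by rewrite divr_gt0.
rewrite ltr_pdivlMr// mulrC => chie.
have := Re_le_bound (psi - chi) c1 xc1; rewrite predual_saB ler_norml.
by move: chie pc; lra.
Qed.

Lemma predual_complete (u : nat -> V) (c : R) : 0 < c ->
  (forall n, `|u n.+1 - u n| < c * half_pow n) ->
  exists psi, forall n, `|psi - u n| <= 4 * c * half_pow n.
Proof.
move=> c0 uc; pose f n := u n.+1 - u n.
have [n|phi _ phiP] := @represented_series _ _ M f (fun n => c * half_pow n) (c * 2)
    (fun n => norm_lt_represented (uc n)).
  rewrite /series /= -mulr_sumr ler_pM2l//.
    have := @series_half_pow R n; rewrite /series /= => ->.
    by have := @half_pow_gt0 R n; lra.
have fu x n : series (fun k => Re (val (f k) x)) n =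
    Re (val (u n) x) - Re (val (u 0%N) x).
  rewrite /series /=; elim: n => [|n IH]; first by rewrite big_nil subrr.
  by rewrite big_nat_recr//= IH predual_saB; lra.
exists (u 0%N + phi) => n.
(* The inner [2 * c * half_pow n] is the geometric tail of the increments; the outer 2 comes from
   [predual_sa_norm_le2]. *)
have -> : 4 * c * half_pow n = 2 * (2 * c * half_pow n) by ring.
apply: predual_sa_norm_le2 => x xx xb.
rewrite predual_saB predual_saD.
have lim1 : (fun m => `|Re (val (u m) x) - Re (val (u n) x)|) @ \oo -->
    `|Re (val (u 0%N) x) + Re (val phi x) - Re (val (u n) x)|.
  apply: cvg_norm; apply: cvgB; last exact: cvg_cst.
  rewrite (_ : (fun m => _) = cst (Re (val (u 0%N) x)) \+
      series (fun k => Re (val (f k) x))).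
    by apply: cvgD; [exact: cvg_cst|exact: phiP].
  by apply/funext => m; rewrite /= fu; lra.
apply: (cvgr_to_le lim1); exists n => // m /= nm.
suff : `|Re (val (u m) x) - Re (val (u n) x)| <=
    2 * c * (half_pow n - half_pow m).
  have := mulr_gt0 c0 (@half_pow_gt0 R m).
  by move: (half_pow m) (half_pow n) => a b; lra.
elim: m nm => [|m IH].
  by rewrite leqn0 => /eqP ->; rewrite !subrr normr0 mulr0.
rewrite leq_eqVlt => /predU1P[->|/IH {}IH]; first by rewrite !subrr normr0 mulr0.
have := le_lt_trans (Re_le_norm (f m) xb) (uc m); rewrite predual_saB.
move: IH; rewrite !ler_norml ltr_norml (@half_powS R m).
by move: (half_pow _) (half_pow _) => a b /andP[? ?] /andP[? ?]; lra.
Qed.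

Lemma represented_norm_le phi (K : R) : represented phi K -> `|phi| <= 2 * K.
Proof.
move=> [xi [eta [cK phiP]]]; apply: predual_sa_norm_le2 => x xx xb.
have xc u : nrm (val x u) <= 1 * nrm u.
  by rewrite mul1r -lecR -!nrmE; exact: xb.
apply: (cvgr_to_le (cvg_norm (phiP x xx))); apply: nearW => n.
apply: le_trans (cK n); apply: le_trans (ler_norm_sum _ _ _) _.
apply: ler_sum => i _; have := ip_cost xi eta i ler01 xc.
by rewrite mul1r.
Qed.

(* The bound is sum_n (omega_(xi_n) + omega_(eta_n)) / 2, where
   omega_u x = <x u, u>. *)
Lemma represented_dominated phi (K : R) : represented phi K ->
  exists psi, [/\ (- psi <= phi)%O, (phi <= psi)%O & `|psi| <= 4 * K].
Proof.
move=> [xi [eta [cK phiP]]].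
have c1 n : series (cost xi xi) n <= 2 * K.
  apply: le_trans (ler_wpM2l _ (cK n)) => //; rewrite /series /= mulr_sumr.
  apply: ler_sum => i _; rewrite /cost; have := sqr_ge0 (nrm (eta i)); lra.
have c2 n : series (cost eta eta) n <= 2 * K.
  apply: le_trans (ler_wpM2l _ (cK n)) => //; rewrite /series /= mulr_sumr.
  apply: ler_sum => i _; rewrite /cost; have := sqr_ge0 (nrm (xi i)); lra.
have [p1 p1P] := predual_of_vectors M c1.
have [p2 p2P] := predual_of_vectors M c2.
have r1 : represented p1 (2 * K) by exists xi, xi.
have r2 : represented p2 (2 * K) by exists eta, eta.
have h0 : 0 <= 2^-1 :> R by rewrite invr_ge0.
exists (2^-1 *: (p1 + p2)).
(* Termwise this is half of [<x (xi + s eta), xi + s eta> >= 0]; the signs [s = 1] and [s = -1] give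
   the two bounds. *)
have lim (s : R) x : positive_op (val x) -> s ^+ 2 = 1 ->
    0 <= Re (val (2^-1 *: (p1 + p2)) x) + s * Re (val phi x).
  move=> x0 s1; have xx := positive_self_adjoint x0.
  rewrite predual_saZ predual_saD.
  have lim : cst 2^-1 \* (series (fun n => ip (val x (xi n)) (xi n)) \+
      series (fun n => ip (val x (eta n)) (eta n))) \+
      cst s \* series (fun n => ip (val x (xi n)) (eta n)) @ \oo -->
      2^-1 * (Re (val p1 x) + Re (val p2 x)) + s * Re (val phi x).
    apply: cvgD; last by apply: cvgM; [exact: cvg_cst|exact: phiP].
    apply: cvgM; first exact: cvg_cst.
    by apply: cvgD; [exact: p1P|exact: p2P].
  apply: (cvgr_to_ge lim); apply: nearW => n.
  rewrite /series /= -big_split !mulr_sumr -big_split /=; apply: sumr_ge0 => i _.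
  have := Re_ge0 (x0 (xi i + s%:C%C *: eta i)); rewrite -/(ip _ _).
  rewrite vn_opD vn_opZ ipDl !ipDr !ipZl !ipZr (self_adjoint_ip (eta i) (xi i) xx).
  by rewrite [ip (eta i) _]ipC !mulrA -expr2 s1; lra.
split.
- apply/predual_leP => x x0; rewrite predual_saN.
  by have := lim 1 x x0 (expr1n _ _); rewrite mul1r; lra.
- apply/predual_leP => x x0.
  by have := lim (-1) x x0; rewrite sqrrN expr1n mulN1r => /(_ erefl); lra.
apply: le_trans (represented_norm_le (representedZ h0 (representedD r1 r2))) _.
lra.
Qed.

(** The values at 1 increase to a finite supremum and control the norms of increments. A sequence
    nearly reaching that supremum has a norm limit, which by closedness of the order is the supremum
    [l] of the net. *)
Lemma net_up_norm (G : directedSet) (x : G -> V) (l : V) : net_up x l ->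
  forall e : R, 0 < e -> exists a, forall b, dle a b -> `|l - x b| < e.
Proof.
move=> [xi [xu xl]]; pose t a := Re (val (x a) vn_one).
have tm a b : dle a b -> t a <= t b.
  by move=> /xi /predual_leP; apply; exact: positive_one.
have dist a b : dle a b -> `|x b - x a| <= 2 * (t b - t a).
  move=> ab; rewrite -predual_saB; apply: positive_norm_le.
  by rewrite predual_subr_ge0; exact: xi.
have [a0] := directed_inhabited G.
have ts : has_sup (range t).
  split; first by exists (t a0), a0.
  exists (Re (val l vn_one)) => _ [a _ <-].
  have /predual_leP : (x a <= l)%O by apply: xu; exists a.
  by apply; exact: positive_one.
pose s := sup (range t).
have tles a : t a <= s by apply: ub_le_sup; [exact: ts.2|exists a].
have step (p : nat * G) : exists b, dle p.2 b /\ s - t b < half_pow p.1.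
  have [_ [b _ <-] sb] := sup_adherent (@half_pow_gt0 R p.1) ts.
  have [c bc pc] := dle_directed b p.2; exists c; split=> //.
  by have := tm _ _ bc; rewrite -/s in sb; lra.
have [h hP] := choice step.
pose g := fix g n := if n is m.+1 then h (m.+1, g m) else h (0%N, a0).
have gs n : s - t (g n) < half_pow n.
  by case: n => [|n]; [exact: (hP (0%N, a0)).2|exact: (hP (n.+1, g n)).2].
have gS n : dle (g n) (g n.+1) by exact: (hP (n.+1, g n)).1.
have [psi psiP] : exists psi, forall n, `|psi - x (g n)| <= 4 * 2 * half_pow n.
  apply: predual_complete => // n; apply: le_lt_trans (dist _ _ (gS n)) _.
  rewrite ltr_pM2l//; apply: le_lt_trans (gs n).
  by rewrite lerD2r.
have lpsi : (l <= psi)%O.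
  apply: xl => _ [a _ <-]; apply: predual_le_closed => e e0.
  (* Ten is 8 for the distance from [psi] to [x (g N)] plus 2 for the distance from there to any
     later [x b]. *)
  have e80 : 0 < e / 10 by rewrite divr_gt0.
  have [N /(_ N (leqnn N)) hN] := half_pow_lt e80.
  have [b ab gb] := dle_directed a (g N).
  exists (x b); first exact: xi.
  rewrite -(subrK (x (g N)) psi) -addrA; apply: le_lt_trans (ler_normD _ _) _.
  rewrite (distrC (x (g N))).
  by have := psiP N; have := dist _ _ gb; have := gs N; have := tles b; lra.
have psil : (psi <= l)%O.
  rewrite -predual_leN2; apply: predual_le_closed => e e0.
  have e80 : 0 < e / 8 by rewrite divr_gt0.
  have [N /(_ N (leqnn N)) hN] := half_pow_lt e80.
  exists (- x (g N)); first by rewrite predual_leN2; apply: xu; exists (g N).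
  by rewrite -opprD normrN; have := psiP N; lra.
have -> : l = psi by apply/eqP; rewrite eq_le lpsi psil.
move=> e e0; have e80 : 0 < e / 10 by rewrite divr_gt0.
have [N /(_ N (leqnn N)) hN] := half_pow_lt e80.
exists (g N) => b gb.
rewrite -(subrK (x (g N)) psi) -addrA; apply: le_lt_trans (ler_normD _ _) _.
rewrite (distrC (x (g N))).
by have := psiP N; have := dist _ _ gb; have := gs N; have := tles b; lra.
Qed.

Lemma net_down_opp (G : directedSet) (x : G -> V) (l : V) :
  net_down x l -> net_up (fun a => - x a) (- l).
Proof.
move=> [xd [xl xu]]; split=> [a b ab|]; first by rewrite predual_leN2; exact: xd.
split=> [_ [a _ <-]|u ub]; first by rewrite predual_leN2; apply: xl; exists a.
rewrite -[u]opprK predual_leN2; apply: xu => _ [a _ <-].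
by rewrite -predual_leN2 opprK; apply: ub; exists a.
Qed.

Lemma net_down_norm (G : directedSet) (x : G -> V) (l : V) : net_down x l ->
  forall e : R, 0 < e -> exists a, forall b, dle a b -> `|l - x b| < e.
Proof.
move=> /net_down_opp /net_up_norm xl e /xl[a ae]; exists a => b /ae.
by rewrite -opprD normrN.
Qed.

(** The bounding nets converge in norm, and [between_norm_le] controls [x] between them. One close
    term for each [e] is enough to put [l] in a norm closure. *)
Lemma order_cvg_norm (G : directedSet) (x : G -> V) (l : V) : order_cvg x l ->
  forall e : R, 0 < e -> exists a, `|l - x a| < e.
Proof.
move=> [y [z [yxz yl zl]]] e e0; have e40 : 0 < e / 8 by rewrite divr_gt0.
have [a aP] := net_up_norm yl e40; have [b bP] := net_down_norm zl e40.
have [c ac bc] := dle_directed a b; exists c.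
have [yx xz] := yxz c.
have : `|x c - y c| <= 2 * `|z c - y c|.
  apply: between_norm_le; first by rewrite predual_subr_ge0.
  by rewrite addrC [X in (_ <= X)%O]addrC predual_leD2l.
have : `|z c - y c| <= `|l - z c| + `|l - y c|.
  by rewrite (distrC l); apply: le_trans (ler_normD _ _); rewrite addrA subrK.
have : `|l - x c| <= `|l - y c| + `|x c - y c|.
  by rewrite (distrC (x c)); apply: le_trans (ler_normD _ _); rewrite addrA subrK.
by have := aP _ ac; have := bP _ bc; lra.
Qed.

(** Each [x n - l] lies between [- psi n] and [psi n] with the [psi n] summable in norm. The tails
    [t n] of their sum decrease to 0 and dominate [psi n], so [l - t n] and [l + t n] squeeze
    [x n]. *)
Lemma norm_order_cvg (x : nat_directed -> V) (l : V) :
  (forall n, `|x n - l| < half_pow n) -> order_cvg x l.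
Proof.
move=> xl.
have /choice[psi psiP] n := represented_dominated (norm_lt_represented (xl n)).
have psi0 n : (0 <= psi n)%O.
  have [p1 p2 _] := psiP n; apply/predual_leP => y y0; rewrite predual_sa0E.
  move/predual_leP/(_ y y0): p1; move/predual_leP/(_ y y0): p2.
  by rewrite predual_saN; lra.
pose w n := \sum_(0 <= k < n) psi k.
have wS n : w n.+1 = w n + psi n by rewrite /w big_nat_recr.
(* The increments have norm at most [4 * half_pow n], and 5 makes the bound strict; the resulting
   rate [20 * half_pow n] explains [e / 20] below. *)
have [|n|W WP] := @predual_complete w 5; first by [].
  rewrite wS addrC addKr; have [_ _ pn] := psiP n.
  by have := @half_pow_gt0 R n; lra.
have wm m n : (m <= n)%N -> (w m <= w n)%O.
  move=> /subnK <-; elim: (n - m)%N => // k IH.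
  apply: (le_trans IH); rewrite addSn wS -{1}[w _]addr0 predual_leD2l.
  exact: psi0.
have wW n : (w n <= W)%O.
  apply: predual_le_closed => e e0; have e20 : 0 < e / 20 by rewrite divr_gt0.
  have [N NP] := half_pow_lt e20.
  exists (w (maxn n N)); first by apply: wm; exact: leq_maxl.
  by have := WP (maxn n N); have := NP _ (leq_maxr n N); lra.
(* [w n] stops before index [n], so the tail [t n] still contains [psi n]. *)
pose t n := W - w n.
have tpsi n : (psi n <= t n)%O.
  by rewrite -predual_subr_ge0 /t -addrA -opprD -wS predual_subr_ge0; exact: wW.
have td m n : (m <= n)%N -> (t n <= t m)%O.
  by move=> /wm mn; rewrite /t predual_leD2l predual_leN2.
have tinf u : (forall n, (u <= t n)%O) -> (u <= 0)%O.
  move=> ut; apply: predual_le_closed => e e0.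
  have e20 : 0 < e / 20 by rewrite divr_gt0.
  have [N /(_ N (leqnn N)) hN] := half_pow_lt e20.
  exists (t N); first exact: ut.
  by rewrite sub0r normrN; have := WP N; lra.
have t0 n : (0 <= t n)%O by rewrite predual_subr_ge0.
exists (fun n => l - t n), (fun n => l + t n); split.
- move=> n; have [p1 p2 _] := psiP n.
  rewrite -[x n](subrK l) [x n - l + l]addrC !predual_leD2l; split.
    by apply: (le_trans _ p1); rewrite predual_leN2.
  exact: le_trans p2 (tpsi n).
- split=> [a b ab|]; first by rewrite predual_leD2l predual_leN2; exact: td.
  split=> [_ [n _ <-]|u ub].
    by rewrite -{2}[l]addr0 predual_leD2l -oppr0 predual_leN2.
  rewrite -predual_subr_ge0 -oppr0 -[u - l]opprK predual_leN2 opprB.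
  apply: tinf => n; rewrite -(predual_leD2l (u - t n)).
  have -> : u - t n + (l - u) = l - t n by rewrite addrC addrA subrK.
  by rewrite subrK; apply: ub; exists n.
split=> [a b ab|]; first by rewrite predual_leD2l; exact: td.
split=> [_ [n _ <-]|u lb].
  by rewrite -{1}[l]addr0 predual_leD2l.
rewrite -predual_subr_ge0 -oppr0 -[l - u]opprK predual_leN2 opprB.
apply: tinf => n; rewrite -(predual_leD2l l) addrC subrK.
by apply: lb; exists n.
Qed.

End PredualOrder.

(** * Comparison of closed sets, and monotone order separability *)

Section Topologies.
Context {R : realType} {H : hilbertSpace R} (M : vonNeumannAlgebra H).
Local Notation V := (predual_sa M).
Implicit Types (X : set V).

Lemma closed_order_closed X : closed X -> order_closed X.
Proof.
move=> Xc G x l Xx /order_cvg_norm xl; apply: Xc => B /nbhs_ballP[e /= e0 eB].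
have [a ae] := xl e e0; exists (x a); split=> //; apply: eB.
by rewrite -ball_normE.
Qed.

Lemma order_closed_seq X : order_closed X -> seq_order_closed X.
Proof. by move=> Xc x l; exact: Xc. Qed.

(** A point of the norm closure is approached from [X] at the rate [half_pow n], hence is an order
    limit of a sequence in [X]. *)
Lemma seq_order_closed_closed X : seq_order_closed X -> closed X.
Proof.
move=> Xc l lX.
have /choice[x xP] : forall n : nat, exists y, X y /\ `|y - l| < @half_pow R n.
  move=> n; have [y [Xy]] := lX _ (nbhsx_ballx l _ (@half_pow_gt0 R n)).
  by rewrite -ball_normE /= distrC => yl; exists y.
apply: (Xc x) => [n|]; first exact: (xP n).1.
by apply: norm_order_cvg => n; exact: (xP n).2.
Qed.

Lemma predual_monotone_order_separable : monotone_order_separable V.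
Proof.
(* Norm convergence of a net yields an increasing sequence of indices with terms arbitrarily close
   to [l]; closedness of the order then makes [l] the extremum of the sequence. *)
have sep (G : directedSet) (x : G -> V) (l : V) :
    (forall e : R, 0 < e -> exists a, forall b, dle a b -> `|l - x b| < e) ->
    exists2 g : nat -> G, (forall n, dle (g n) (g n.+1)) &
      forall e : R, 0 < e -> exists n, `|l - x (g n)| < e.
  move=> xl; have [a0] := directed_inhabited G.
  have step (p : nat * G) : exists b, dle p.2 b /\ `|l - x b| < @half_pow R p.1.
    have [a aP] := xl _ (@half_pow_gt0 R p.1).
    have [c ac pc] := dle_directed a p.2.
    by exists c; split=> //; exact: aP.
  have [h hP] := choice step.
  pose g := fix g n := if n is m.+1 then h (m.+1, g m) else h (0%N, a0).
  exists g => [n|e e0]; first exact: (hP (n.+1, g n)).1.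
  have [N /(_ N (leqnn N)) hN] := half_pow_lt e0; exists N.
  by apply: lt_trans hN; case: N => [|N];
    [exact: (hP (0%N, a0)).2|exact: (hP (N.+1, g N)).2].
split=> G x l xl.
  have [g gS gl] := sep _ _ _ (net_up_norm xl); exists g => //.
  have [_ [xu _]] := xl; split=> [_ [n _ <-]|u ub].
    by apply: xu; exists (g n).
  rewrite -predual_leN2; apply: predual_le_closed => e /gl[n gn].
  exists (- x (g n)); first by rewrite predual_leN2; apply: ub; exists n.
  by rewrite -opprD normrN.
have [g gS gl] := sep _ _ _ (net_down_norm xl); exists g => //.
have [_ [xu _]] := xl; split=> [_ [n _ <-]|u ub].
    by apply: xu; exists (g n).
apply: predual_le_closed => e /gl[n gn]; exists (x (g n)) => //.
by apply: ub; exists n.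
Qed.

End Topologies.

Theorem theorem5 (R : realType) (H : hilbertSpace R) (M : vonNeumannAlgebra H) :
  [/\ tau_norm (predual_sa M) = tau_o (predual_sa M),
      tau_o (predual_sa M) = tau_os (predual_sa M) &
      monotone_order_separable (predual_sa M)].
Proof.
have oE U : tau_o (predual_sa M) U = order_closed (~` U) by [].
have osE U : tau_os (predual_sa M) U = seq_order_closed (~` U) by [].
(* On complements, norm closed implies order closed, which implies sequentially order closed, which
   implies norm closed. *)
split; last exact: predual_monotone_order_separable.
  apply/seteqP; split=> U; rewrite oE /tau_norm.
    by move=> oU; apply: closed_order_closed; rewrite closedC.
  by move=> /order_closed_seq/seq_order_closed_closed; rewrite closedC.
apply/seteqP; split=> U; rewrite oE osE; first exact: order_closed_seq.
by move=> /seq_order_closed_closed/closed_order_closed.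
Qed.
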